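(* Let $A=\oplus_{h\in H}A_h$ be a graded pseudo-Frobenius algebra, let $(e_i)_{i\in I}$ be a weakly basic distinguished family of orthogonal idempotents and let $D(A)=D({}_AA_A)$ be the dual graded bimodule of ${}_AA_A$. The following assertions hold: 1. There is an automorphism of (ungraded) algebras $\eta:A\longrightarrow A$, which permutes the idempotents $e_i$ and maps homogeneous elements of $\bigcup_{i,j\in I}e_iAe_j$ onto homogeneous elements, such that ${}_1A_\eta$ is isomorphic to $D(A)$ as an ungraded $A$-bimodule. 2. If the degree map $\mathbf h:I\longrightarrow H$ associated to a graded Nakayama form $(-,-):A\times A\longrightarrow K$ takes constant value $h$, then $\eta$ can be chosen to be graded and such that $D(A)$ is isomorphic to ${}_1A_\eta[h]$ as graded $A$-bimodules.
   Context: $K$ is a fixed field and $H$ a fixed abelian group, written additively. Algebras are associative $K$-algebras, not necessarily unital. A *graded algebra with enough idempotents* is an $H$-graded algebra $A=\oplus_{h\in H}A_h$ having a family $(e_i)_{i\in I}$ of nonzero orthogonal idempotents, homogeneous of degree $0$, with $\oplus_{i\in I}e_iA=A=\oplus_{i\in I}Ae_i$ (a *distinguished family* ). $A$ is *locally finite dimensional* if $\dim_K e_iA_he_j<\infty$ for all $i,j\in I$, $h\in H$. Modules are unital; $M[k]$ is $M$ with grading $M[k]_h=M_{k+h}$. $A\text{-}Gr$ (resp. $Gr\text{-}A$) is the category of graded left (resp. right) $A$-modules with degree $0$ homomorphisms. The graded Jacobson radical $J^{gr}(A)$ is the intersection of all maximal graded left ideals of $A$ (equivalently, of all maximal graded right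 ideals). A locally finite dimensional graded algebra with enough idempotents is *weakly basic* if it has a distinguished family $(e_i)_{i\in I}$ (called *weakly basic* ) such that each $e_iA_0e_i$ is local and $e_iAe_j\subseteq J^{gr}(A)$ for all $i\neq j$. For graded $K$-vector spaces $V,W$ with finite dimensional homogeneous components, put $D(V)=\oplus_h\mathrm{Hom}_K(V_h,K)$. A bilinear form $V\times W\to K$ is *of degree $d\in H$* if $(V_h,W_k)\neq 0$ implies $h+k=d$; such a form is *nondegenerate* if the induced maps $W\to D(V)$ and $V\to D(W)$ are bijective. A *graded Nakayama form* for a weakly basic $A$ is a bilinear form $(-,-):A\times A\to K$ such that: (i) $(ab,c)=(a,bc)$ for all $a,b,c\in A$; (ii) for each $i\in I$ there is a unique $\nu(i)\in I$ with $(e_iA,Ae_{\nu(i)})\neq 0$, and $\nu:I\to I$ is a bijection; (iii) there is a map $\mathbf h:I\to H$ (the *degree map* ) such that, for all $i,j\in I$, the induced form $e_iAe_j\times e_jAe_{\nu(i)}\to K$ is a nondegenerate graded bilinear form of degree $\mathbf h(i)$. A graded algebra is *graded pseudo-Frobenius* if it is weakly basic and admits a graded Nakayama form; equivalently, if it is weakly basic and in $A\text{-}Gr$ (resp. $Gr\text{-}A$) the finitely generated projective objects coincide with the finitely cogenerated injective ones. $D(A)=D({}_AA_A)$ is the space of linear forms $f:A\to K$ with $f(e_iA_he_j)=0$ for all but finitely many $(i,j,h)\in I\times I\times H$, with bimodule structure $(afb)(x)=f(bxa)$ and grading $D(A)_h=\{f: f(A_k)=0\ \forall k\neq -h\}$.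 For an algebra automorphism $\eta$ of $A$, ${}_1A_\eta$ is $A$ as a vector space (graded, if $\eta$ is graded) with bimodule structure $a\cdot x\cdot b=ax\eta(b)$. An automorphism is *graded* if it preserves degrees. *)

(* Defs.v *)
From HB Require Import structures.
From mathcomp Require Import all_boot all_order all_algebra.
From mathcomp Require Import finmap.
From mathcomp Require Import sesquilinear.
From mathcomp Require Import boolp classical_sets functions cardinality.

Set Implicit Arguments.
Unset Strict Implicit.
Unset Printing Implicit Defensive.

Import GRing.Theory.

Local Open Scope classical_set_scope.
Local Open Scope ring_scope.

Section DirectSums.
Context {K : fieldType} {M : lmodType K}.

Definition subspace (V : set M) : Prop := submod_closed [in V].

Lemma subspaceP (V : set M) :
  subspace V <-> V 0 /\ (forall a u v, V u -> V v -> V (a *: u + v)).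
Proof.
split=> -[V0 VL]; split.
- by move: V0; rewrite !inE.
- by move=> a u v Vu Vv; have := VL a u v; rewrite !inE; apply.
- by rewrite !inE.
- by move=> a u v; rewrite !inE; apply: VL.
Qed.

Definition sum_of {T : choiceType} (V : T -> set M) : set M :=
  [set x | exists (s : {fset T}) (f : T -> M),
     (forall t, t \in s -> V t (f t)) /\ x = \sum_(t <- s) f t].

Definition independent {T : choiceType} (V : T -> set M) : Prop :=
  forall (s : {fset T}) (f : T -> M), (forall t, t \in s -> V t (f t)) ->
    \sum_(t <- s) f t = 0 -> forall t, t \in s -> f t = 0.

Definition is_direct_sum {T : choiceType} (V : T -> set M) (W : set M) : Prop :=
  sum_of V = W /\ independent V.

Section Projections.
Context {T : choiceType} {V : T -> set M}.
Hypothesis V_sub : forall t, subspace (V t).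
Hypothesis V_sum : is_direct_sum V setT.

Let V0 t : V t 0. Proof. by have /subspaceP[] := V_sub t. Qed.
Let VL t a u v : V t u -> V t v -> V t (a *: u + v).
Proof. by have /subspaceP[_] := V_sub t; apply. Qed.

Let decomp (x : M) (s : {fset T}) (g : T -> M) : Prop :=
  [/\ forall t, V t (g t), forall t, t \notin s -> g t = 0
    & x = \sum_(t <- s) g t].

Let decomp_ex x : exists sg : {fset T} * (T -> M), decomp x sg.1 sg.2.
Proof.
have [sV _] := V_sum; have : sum_of V x by rewrite sV.
move=> [s [f [fV ->]]]; exists (s, fun t => if t \in s then f t else 0).
split=> [t|t|] /=.
- by case: ifP => [/fV //|_]; apply: V0.
- by move/negbTE->.
- by apply: eq_big_seq => t ->.
Qed.

Let decomp_sup x s s' g : (s `<=` s')%fset -> decomp x s g -> decomp x s' g.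
Proof.
move=> ss' [gV g0 ->]; split=> // [t ts'|].
  by apply: g0; apply: contra ts'; apply: (fsubsetP ss').
by apply: big_fset_incl => // t _ ts; apply: g0.
Qed.

Let decomp_uniq x s g s' g' : decomp x s g -> decomp x s' g' -> g =1 g'.
Proof.
move=> d d'; have [gV g0 xE] := decomp_sup (fsubsetUl s s') d.
have [gV' g0' xE'] := decomp_sup (fsubsetUr s s') d'.
move=> t; have [ts|ts] := boolP (t \in (s `|` s')%fset); last by rewrite g0 ?g0'.
have [_ ind] := V_sum; apply/eqP; rewrite -subr_eq0; apply/eqP.
apply: (ind (s `|` s')%fset (fun t => g t - g' t)) => // [u _|].
  by rewrite -[X in _ - X]scale1r -scaleNr addrC; apply: VL.
by rewrite sumrB -xE -xE' subrr.
Qed.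

Lemma direct_sum_proj : exists pi : T -> M -> M,
  [/\ forall t, linear (pi t), forall t x, V t (pi t x),
      forall t x, V t x -> pi t x = x,
      forall t u x, V u x -> u <> t -> pi t x = 0
    & forall x, exists s : {fset T},
        (forall t, t \notin s -> pi t x = 0) /\ x = \sum_(t <- s) pi t x].
Proof.
have [d dP] := choice decomp_ex; exists (fun t x => (d x).2 t).
have single u x : V u x -> decomp x [fset u]%fset (fun t => if t == u then x else 0).
  move=> Vx; split=> [t|t|]; first by case: eqP => [->|_] //; apply: V0.
    by rewrite inE => /negbTE->.
  by rewrite big_seq_fset1 eqxx.
split.
- move=> t a x y; set s := ((d x).1 `|` (d y).1)%fset.
  have [gV g0 xE] := decomp_sup (fsubsetUl _ _ : _ `<=` s)%fset (dP x).
  have [gV' g0' yE] := decomp_sup (fsubsetUr _ _ : _ `<=` s)%fset (dP y).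
  apply: (decomp_uniq (dP _) (s' := s) (g' := fun t => a *: (d x).2 t + (d y).2 t)).
  split=> [u|u us|]; first exact: VL.
    by rewrite g0 ?g0' // scaler0 addr0.
  by rewrite big_split /= -scaler_sumr -xE -yE.
- by move=> t x; have [] := dP x.
- by move=> t x /single Vx; rewrite (decomp_uniq (dP x) Vx) eqxx.
- move=> t u x /single Vx /eqP ut.
  by rewrite (decomp_uniq (dP x) Vx) eq_sym (negbTE ut).
- by move=> x; exists (d x).1; have [] := dP x.
Qed.

End Projections.

Definition finite_dim (V : set M) : Prop :=
  exists s : seq M, (forall x, x \in s -> V x) /\
    (forall x, V x -> exists c : 'I_(size s) -> K, x = \sum_k c k *: s`_k).

End DirectSums.

HB.mixin Record Lmodule_isNuAlgebra (K : fieldType) (A : Type)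
    of GRing.Lmodule K A := {
  numul : A -> A -> A;
  numulA : associative numul;
  numulDl : left_distributive numul +%R;
  numulDr : right_distributive numul +%R;
  numulZl : forall (c : K) (x y : A), numul (c *: x) y = c *: numul x y;
  numulZr : forall (c : K) (x y : A), numul x (c *: y) = c *: numul x y
}.

(* Associative K-algebras, not necessarily unital. *)
#[short(type="nuAlgType")]
HB.structure Definition NuAlgebra (K : fieldType) :=
  {A of GRing.Lmodule K A & Lmodule_isNuAlgebra K A}.

Notation "x ** y" := (numul x y) (at level 40, left associativity) : ring_scope.

Section NuAlgebraTheory.
Context {K : fieldType} {A : nuAlgType K}.

Lemma numul_linearl (y : A) : linear (fun x => x ** y).
Proof. by move=> c x x'; rewrite numulDl numulZl. Qed.

Lemma numul_linearr (x : A) : linear (numul x).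
Proof. by move=> c y y'; rewrite numulDr numulZr. Qed.

Lemma numul0x (x : A) : 0 ** x = 0.
Proof. by rewrite -[in LHS](scale0r (0 : A)) numulZl scale0r. Qed.

Lemma numulx0 (x : A) : x ** 0 = 0.
Proof. by rewrite -[in LHS](scale0r (0 : A)) numulZr scale0r. Qed.

Lemma numul_suml (T : Type) (r : seq T) (F : T -> A) (x : A) :
  (\sum_(t <- r) F t) ** x = \sum_(t <- r) F t ** x.
Proof.
by apply: (big_morph (fun y => y ** x)) => [y z|]; rewrite ?numulDl ?numul0x.
Qed.

Lemma numul_sumr (T : Type) (r : seq T) (F : T -> A) (x : A) :
  x ** (\sum_(t <- r) F t) = \sum_(t <- r) x ** F t.
Proof.
by apply: (big_morph (numul x)) => [y z|]; rewrite ?numulDr ?numulx0.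
Qed.

End NuAlgebraTheory.

Record bimodule {K : fieldType} (A : nuAlgType K) := Bimodule {
  bimod_sort :> lmodType K;
  lact : A -> bimod_sort -> bimod_sort;
  ract : bimod_sort -> A -> bimod_sort;
  lact_linearl : forall m, linear (lact^~ m);
  lact_linearr : forall a, linear (lact a);
  ract_linearl : forall a, linear (ract^~ a);
  ract_linearr : forall m, linear (ract m);
  lactA : forall a b m, lact a (lact b m) = lact (a ** b) m;
  ractA : forall m a b, ract (ract m a) b = ract m (a ** b);
  lractA : forall a m b, lact a (ract m b) = ract (lact a m) b;
  lact_unital : forall m, exists s : seq (A * bimod_sort),
    m = \sum_(p <- s) lact p.1 p.2;
  ract_unital : forall m, exists s : seq (bimod_sort * A),
    m = \sum_(p <- s) ract p.1 p.2
}.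

Record is_bimodule_iso {K : fieldType} {A : nuAlgType K} {M N : bimodule A}
    (phi : M -> N) : Prop := {
  bimod_iso_linear : linear phi;
  bimod_iso_lact : forall a m, phi (lact a m) = lact a (phi m);
  bimod_iso_ract : forall m a, phi (ract m a) = ract (phi m) a;
  bimod_iso_bij : bijective phi
}.

Definition bimodule_isomorphic {K : fieldType} {A : nuAlgType K}
    (M N : bimodule A) : Prop :=
  exists phi : M -> N, is_bimodule_iso phi.

Record algAut {K : fieldType} (A : nuAlgType K) := AlgAut {
  alg_aut_fun :> A -> A;
  alg_aut_linear : linear alg_aut_fun;
  alg_autM : {morph alg_aut_fun : x y / x ** y};
  alg_aut_bij : bijective alg_aut_fun
}.

HB.mixin Record NuAlgebra_isGraded (K : fieldType) (H : zmodType) (A : Type)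
    of NuAlgebra K A := {
  hcomp : H -> set A;
  hcomp_subspace : forall h, subspace (hcomp h);
  hcomp_direct : is_direct_sum hcomp setT;
  hcompM : forall h k x y,
    hcomp h x -> hcomp k y -> hcomp (h + k) (x ** y)
}.

#[short(type="grAlgType")]
HB.structure Definition GradedAlgebra (K : fieldType) (H : zmodType) :=
  {A of NuAlgebra K A & NuAlgebra_isGraded K H A}.

Section DistinguishedFamilies.
Context {K : fieldType} {H : zmodType} {A : grAlgType K H}.

Definition homogeneous : set A := [set x | exists h : H, hcomp h x].

Definition distinguished {I : choiceType} (e : I -> A) : Prop :=
  [/\ (forall i, e i <> 0),
      (forall i, e i ** e i = e i),
      (forall i j, i <> j -> e i ** e j = 0),
      (forall i, hcomp (0 : H) (e i)) &
      is_direct_sum (fun i => [set e i ** a | a in setT]) setT /\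
      is_direct_sum (fun i => [set a ** e i | a in setT]) setT].

(* corner e i j X is e_i X e_j. *)
Definition corner {I : Type} (e : I -> A) (i j : I) (X : set A) : set A :=
  [set e i ** x ** e j | x in X].

End DistinguishedFamilies.

HB.mixin Record GradedAlgebra_hasEnoughIdempotents (K : fieldType)
    (H : zmodType) (A : Type) of GradedAlgebra K H A := {
  enough_idempotents : exists (I : choiceType) (e : I -> A), @distinguished K H A I e
}.

#[short(type="eiGrAlgType")]
HB.structure Definition EnoughIdempotentsGradedAlgebra (K : fieldType)
    (H : zmodType) :=
  {A of GradedAlgebra K H A & GradedAlgebra_hasEnoughIdempotents K H A}.

Record dfamily {K : fieldType} {H : zmodType} (A : grAlgType K H)
    (I : choiceType) := DFamily {
  dfun :> I -> A;
  dfamilyP : distinguished dfun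
}.


Section DistinguishedFamilyTheory.
Context {K : fieldType} {H : zmodType} {A : grAlgType K H} {I : choiceType}.
Variable e : dfamily A I.

Lemma hcompD h (x y : A) : hcomp (h : H) x -> hcomp h y -> hcomp h (x + y).
Proof.
move=> hx hy; have /subspaceP[_ hL] := @hcomp_subspace K H A h.
by rewrite -[x]scale1r; apply: hL.
Qed.

Lemma hcomp0 (h : H) : hcomp h (0 : A).
Proof. by have /subspaceP[] := @hcomp_subspace K H A h. Qed.

Lemma idemE i : e i ** e i = e i. Proof. by have [] := dfamilyP e. Qed.

Lemma idem_orth i j : i <> j -> e i ** e j = 0.
Proof. by have [_ _ + _ _] := dfamilyP e; apply. Qed.

Lemma idem_deg0 i : hcomp (0 : H) (e i). Proof. by have [] := dfamilyP e. Qed.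

Lemma corner_ind (P : A -> Prop) :
  P 0 -> (forall x y, P x -> P y -> P (x + y)) ->
  (forall i j (h : H) x, corner e i j (hcomp h) x -> P x) -> forall x, P x.
Proof.
move=> P0 PD Pc.
have PS (T : choiceType) (s : {fset T}) (f : T -> A) :
    (forall t, t \in s -> P (f t)) -> P (\sum_(t <- s) f t).
  by move=> Pf; rewrite big_seq_cond; apply: big_ind => // t; rewrite andbT; apply: Pf.
have [_ _ _ _ [[sl _] [sr _]]] := dfamilyP e.
move=> x.
have : sum_of (fun i => [set e i ** a | a in setT]) x by rewrite sl.
move=> [s [f [fE ->]]]; apply: (PS) => i /fE[a _ <-].
have : sum_of (fun j => [set b ** e j | b in setT]) (e i ** a) by rewrite sr.
move=> [s' [g [gE aE]]]; rewrite -idemE -numulA aE numul_sumr.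
apply: (PS) => j /gE[b _ <-].
have : sum_of hcomp b by have [-> _] := @hcomp_direct K H A.
move=> [s'' [c [cE ->]]]; rewrite numul_suml numul_sumr; apply: (PS) => h /cE ch.
by rewrite numulA; apply: (Pc i j h); exists (c h).
Qed.

Lemma corner_hcomp i j (h : H) x : corner e i j (hcomp h) x -> hcomp h x.
Proof.
move=> [y hy <-]; rewrite -[h]addr0 -[h]add0r.
by apply: hcompM (idem_deg0 _); apply: hcompM (idem_deg0 _) hy.
Qed.

Lemma cornerM i j k l (h p : H) x a :
    corner e i j (hcomp h) x -> corner e k l (hcomp p) a ->
  corner e i l (hcomp (h + p)) (x ** a) /\ (j <> k -> x ** a = 0).
Proof.
move=> cx ca; split=> [|jk].
  exists (x ** a); first by apply: hcompM; apply: corner_hcomp; eassumption.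
  case: cx ca => [y _ <-] [z _ <-].
  by rewrite !numulA idemE -!numulA idemE.
case: cx ca => [y _ <-] [z _ <-].
by rewrite !numulA -[_ ** e j ** e k]numulA idem_orth // numulx0 !numul0x.
Qed.

End DistinguishedFamilyTheory.

(* D(A) consists of the linear forms on A vanishing on e_i A_h e_j for almost all
   (i, j, h), with (a f b)(x) = f (b x a). *)
Section Duals.
Context {K : fieldType} {H : zmodType} {A : grAlgType K H} {I : choiceType}.
Variable e : dfamily A I.

Definition dual_supp (f : A -> K) : set (I * I * H) :=
  [set t | exists2 x, corner e t.1.1 t.1.2 (hcomp t.2) x & f x <> 0].

Definition in_dual (f : A -> K^o) : Prop :=
  scalar f /\ finite_set (dual_supp f).

Definition dual_pred : {pred A -> K^o} := [pred f | `[< in_dual f >]].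

Lemma dual_submod_closed : submod_closed dual_pred.
Proof.
split=> [|a f g /asboolP[fL fS] /asboolP[gL gS]]; apply/asboolP; split.
- by move=> a x y; rewrite mulr0 addr0.
- by apply: (@sub_finite_set _ _ set0) => // t [x _]; case.
- move=> b x y; rewrite /= !fctE fL gL !scalerDr /=.
  by rewrite mulrDr !addrA /GRing.scale /= mulrCA; congr (_ + _); rewrite addrAC.
- apply: (@sub_finite_set _ _ (dual_supp f `|` dual_supp g)).
    move=> t [x xt fgx]; have [fx|fx] := pselect (f x = 0); last by left; exists x.
    by right; exists x => // gx; apply: fgx; rewrite !fctE fx gx scaler0 addr0.
  by rewrite finite_setU.
Qed.

HB.instance Definition _ :=
  GRing.isSubmodClosed.Build K (A -> K^o) dual_pred dual_submod_closed.

Record dual := Dual { dual_fun :> A -> K^o; _ : dual_fun \in dual_pred }.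
HB.instance Definition _ := [isSub for dual_fun].
HB.instance Definition _ := [Choice of dual by <:].
HB.instance Definition _ := [SubChoice_isSubLmodule of dual by <:].

Lemma dual_linear (f : dual) : scalar f.
Proof. by case: f => f /= /asboolP[]. Qed.

Lemma dual_finite (f : dual) : finite_set (dual_supp f).
Proof. by case: f => f /= /asboolP[]. Qed.

Lemma dual0 (f : dual) : f 0 = 0.
Proof.
by have := dual_linear f (-1) 0 0; rewrite scaleN1r addNr mulN1r addNr.
Qed.

Lemma dual_additive (f : dual) x y : f (x + y) = f x + f y.
Proof. by rewrite -[x]scale1r dual_linear mul1r scale1r. Qed.

Lemma dual_eq (f g : dual) : (forall x, f x = g x) -> f = g.
Proof. by move=> fg; apply/val_inj/funext. Qed.

Lemma dualD (f g : dual) x : (f + g) x = f x + g x. Proof. by []. Qed.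
Lemma dualZ a (f : dual) x : (a *: f) x = a * f x. Proof. by []. Qed.

Lemma dual_lact_subproof (a : A) (f : dual) :
  ((fun x => f (x ** a)) : A -> K^o) \in dual_pred.
Proof.
apply/asboolP; split=> [b x y|]; first by rewrite numul_linearl dual_linear.
elim/(@corner_ind _ _ _ _ e): a => [|a b fa fb|k l p a cka].
- apply: (@sub_finite_set _ _ set0) => // t [x _]; case.
  by rewrite numulx0 dual0.
- apply: (@sub_finite_set _ _ (dual_supp (fun x => f (x ** a)) `|`
                               dual_supp (fun x => f (x ** b)))).
    move=> t [x xt fx]; have [fxa|fxa] := pselect (f (x ** a) = 0); last first.
      by left; exists x.
    right; exists x => // fxb; apply: fx.
    by rewrite numulDr dual_additive fxa fxb addr0.
  by rewrite finite_setU.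
- apply: (@sub_finite_set _ _ [set (t.1.1, k, t.2 - p) | t in dual_supp f]).
    move=> [[i j] h] /= [x xt fx]; have [xa xa0] := cornerM xt cka.
    have jk : j = k.
      by apply: contrapT => /xa0 x0; apply: fx; rewrite x0 dual0.
    by exists (i, l, h + p); [exists (x ** a)|rewrite /= addrK jk].
  exact/finite_image/dual_finite.
Qed.

Lemma dual_ract_subproof (f : dual) (a : A) :
  ((fun x => f (a ** x)) : A -> K^o) \in dual_pred.
Proof.
apply/asboolP; split=> [b x y|]; first by rewrite numul_linearr dual_linear.
elim/(@corner_ind _ _ _ _ e): a => [|a b fa fb|k l p a cka].
- apply: (@sub_finite_set _ _ set0) => // t [x _]; case.
  by rewrite numul0x dual0.
- apply: (@sub_finite_set _ _ (dual_supp (fun x => f (a ** x)) `|`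
                               dual_supp (fun x => f (b ** x)))).
    move=> t [x xt fx]; have [fxa|fxa] := pselect (f (a ** x) = 0); last first.
      by left; exists x.
    right; exists x => // fxb; apply: fx.
    by rewrite numulDl dual_additive fxa fxb addr0.
  by rewrite finite_setU.
- apply: (@sub_finite_set _ _ [set (l, t.1.2, t.2 - p) | t in dual_supp f]).
    move=> [[i j] h] /= [x xt fx]; have [ax ax0] := cornerM cka xt.
    have li : l = i.
      by apply: contrapT => /ax0 x0; apply: fx; rewrite x0 dual0.
    by exists (k, j, p + h); [exists (a ** x)|rewrite /= addrAC subrr add0r li].
  exact/finite_image/dual_finite.
Qed.

Definition dual_lact (a : A) (f : dual) : dual := Dual (dual_lact_subproof a f).
Definition dual_ract (f : dual) (a : A) : dual := Dual (dual_ract_subproof f a).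

Lemma dual_sumE (T : Type) (r : seq T) (F : T -> dual) x :
  (\sum_(t <- r) F t) x = \sum_(t <- r) F t x.
Proof. exact: (big_morph (fun f : dual => f x)). Qed.

Lemma dual_ext (f g : dual) :
  (forall i j (h : H) x, corner e i j (hcomp h) x -> f x = g x) -> f = g.
Proof.
move=> fg; apply: dual_eq.
apply: (@corner_ind _ _ _ _ e (fun x => f x = g x)) => // [|x y fgx fgy].
  by rewrite !dual0.
by rewrite !dual_additive fgx fgy.
Qed.

Lemma dual_lact_unital (f : dual) :
  exists s : seq (A * dual), f = \sum_(p <- s) dual_lact p.1 p.2.
Proof.
have fin : finite_set [set t.1.2 | t in dual_supp f].
  exact/finite_image/dual_finite.
exists [seq (e j, f) | j <- fset_set [set t.1.2 | t in dual_supp f]].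
apply: dual_ext => i j h x xc; rewrite big_map dual_sumE /=.
have xj k : x ** e k = if k == j then x else 0.
  case: xc => y _ <-; case: eqP => [->|/nesym kj].
    by rewrite -numulA idemE.
  by rewrite -numulA idem_orth // numulx0.
have [fx|fx] := pselect (f x = 0).
  by rewrite fx big1 // => k _; rewrite xj; case: ifP; rewrite ?fx ?dual0.
rewrite (bigD1_seq j) /= ?fset_uniq //; last first.
  by rewrite in_fset_set // inE; exists (i, j, h) => //; exists x.
by rewrite xj eqxx big1 ?addr0 // => k /negbTE kj; rewrite xj kj dual0.
Qed.

Lemma dual_ract_unital (f : dual) :
  exists s : seq (dual * A), f = \sum_(p <- s) dual_ract p.1 p.2.
Proof.
have fin : finite_set [set t.1.1 | t in dual_supp f].
  exact/finite_image/dual_finite.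
exists [seq (f, e i) | i <- fset_set [set t.1.1 | t in dual_supp f]].
apply: dual_ext => i j h x xc; rewrite big_map dual_sumE /=.
have xi k : e k ** x = if k == i then x else 0.
  case: xc => y _ <-; case: eqP => [->|ki].
    by rewrite !numulA idemE.
  by rewrite !numulA idem_orth // !numul0x.
have [fx|fx] := pselect (f x = 0).
  by rewrite fx big1 // => k _; rewrite xi; case: ifP; rewrite ?fx ?dual0.
rewrite (bigD1_seq i) /= ?fset_uniq //; last first.
  by rewrite in_fset_set // inE; exists (i, j, h) => //; exists x.
by rewrite xi eqxx big1 ?addr0 // => k /negbTE ki; rewrite xi ki dual0.
Qed.

Definition dual_bimodule : bimodule A.
Proof.
refine (@Bimodule K A dual dual_lact dual_ract _ _ _ _ _ _ _
          dual_lact_unital dual_ract_unital).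
- by move=> f c a b; apply: dual_eq => x /=; rewrite numul_linearr dual_linear.
- by move=> a c f g; apply: dual_eq.
- by move=> a c f g; apply: dual_eq.
- by move=> f c a b; apply: dual_eq => x /=; rewrite numul_linearl dual_linear.
- by move=> a b f; apply: dual_eq => x /=; rewrite numulA.
- by move=> f a b; apply: dual_eq => x /=; rewrite numulA.
- by move=> a f b; apply: dual_eq => x /=; rewrite numulA.
Defined.

Definition dual_comp (h : H) : set dual_bimodule :=
  [set f : dual | forall k (x : A), k <> - h -> hcomp k x -> f x = 0].

End Duals.

Arguments dual_comp {K H A I} e h f.


Record grBimodule {K : fieldType} {H : zmodType} (A : grAlgType K H) :=
  GrBimodule {
    gr_bimod :> bimodule A;
    gr_comp : H -> set gr_bimod;
    gr_comp_subspace : forall h, subspace (gr_comp h);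
    gr_comp_direct : is_direct_sum gr_comp setT;
    gr_comp_lact : forall h k a m,
      hcomp h a -> gr_comp k m -> gr_comp (h + k) (lact a m);
    gr_comp_ract : forall h k m a,
      gr_comp h m -> hcomp k a -> gr_comp (h + k) (ract m a)
  }.

Definition gr_bimodule_isomorphic {K : fieldType} {H : zmodType}
    {A : grAlgType K H} (M N : grBimodule A) : Prop :=
  exists phi : M -> N, is_bimodule_iso phi /\
    (forall h m, gr_comp h m -> gr_comp h (phi m)).

Section GradedDual.
Context {K : fieldType} {H : zmodType} {A : grAlgType K H} {I : choiceType}.
Variable e : dfamily A I.

Lemma dual_comp_subspace h : subspace (dual_comp e h).
Proof.
apply/subspaceP; split=> [|a f g fh gh] k x kh xk; first by [].
by rewrite dualD dualZ (fh k x) // (gh k x) // mulr0 addr0.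
Qed.

Lemma dual_comp_direct : is_direct_sum (dual_comp e) setT.
Proof.
have [pi [piL piV pi_id pi0 pi_sum]] :=
  direct_sum_proj (@hcomp_subspace K H A) (@hcomp_direct K H A).
split; last first.
  move=> s f fV f0 h hs; apply: dual_eq => x /=; have [u [_ xE]] := pi_sum x.
  rewrite [in f h x]xE (big_morph (f h : A -> K) (dual_additive (f h)) (dual0 (f h))).
  rewrite big1 // => t _; have [->|/eqP th] := eqVneq t (- h); last first.
    by apply: (fV h hs t).
  have := congr1 (fun g : dual e => g (pi (- h) x)) f0.
  rewrite dual_sumE (big_fsetD1 h) //= big_seq big1 ?addr0 // => v.
  rewrite !inE => /andP[vh vs]; apply: (fV v vs (- h)) => //.
  by move/oppr_inj/esym/eqP; rewrite (negbTE vh).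
apply/seteqP; split=> // f _.
have fpi h : ((fun x => f (pi (- h) x)) : A -> K^o) \in dual_pred e.
  apply/asboolP; split=> [a x y|]; first by rewrite piL dual_linear.
  apply: sub_finite_set (dual_finite f) => -[[i j] k] /= [x xc fx].
  exists x => //; have xk := corner_hcomp xc.
  have [kh|kh] := pselect (k = - h); first by move: fx; rewrite pi_id // -kh.
  by case: fx; rewrite (pi0 _ k) // dual0.
have fin : finite_set [set - t.2 | t in dual_supp e f].
  exact/finite_image/dual_finite.
exists (fset_set [set - t.2 | t in dual_supp e f]), (fun h => Dual (fpi h)).
split=> [h _ k x kh xk /=|]; first by rewrite (pi0 _ k) // dual0.
apply: dual_ext => i j k x xc; rewrite dual_sumE /=; have xk := corner_hcomp xc.
have fx h : f (pi (- h) x) = if h == - k then f x else 0.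
  case: eqP => [->|hk]; first by rewrite opprK pi_id.
  by rewrite (pi0 _ k) ?dual0 // => kh; apply: hk; rewrite kh opprK.
have [fx0|fx0] := pselect (f x = 0).
  by rewrite big1 // => h _; rewrite fx fx0 if_same.
rewrite (big_fsetD1 (- k)) /=; last first.
  by rewrite in_fset_set // inE; exists (i, j, k) => //; exists x.
rewrite fx eqxx big_seq big1 ?addr0 // => h.
by rewrite !inE fx => /andP[/negbTE->].
Qed.

Definition gr_dual : grBimodule A.
Proof.
refine (@GrBimodule K H A (dual_bimodule e) (dual_comp e)
  dual_comp_subspace dual_comp_direct _ _).
- move=> h k a f ah fk l x lhk xl /=; apply: (fk (l + h)); last exact: hcompM.
  by move=> lh; apply: lhk; rewrite opprD addrC -lh addrK.
- move=> h k f a fh ak l x lhk xl /=; apply: (fh (k + l)); last exact: hcompM.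
  by move=> kl; apply: lhk; rewrite opprD -kl addrAC subrr add0r.
Defined.

End GradedDual.

Record grAlgAut {K : fieldType} {H : zmodType} (A : grAlgType K H) :=
  GrAlgAut {
    gr_alg_aut :> algAut A;
    gr_alg_autP : forall (h : H) x, hcomp h x -> hcomp h (gr_alg_aut x)
  }.

Section Twist.
Context {K : fieldType} {H : zmodType} {A : eiGrAlgType K H}.

Lemma numul_unitall (x : A) : exists s : seq (A * A),
  x = \sum_(p <- s) p.1 ** p.2.
Proof.
have [I [e [_ ee _ _ [[sl _] _]]]] := @enough_idempotents K H A.
have : sum_of (fun i => [set e i ** a | a in setT]) x by rewrite sl.
move=> [s [f [fE ->]]]; exists [seq (e i, f i) | i <- s]; rewrite big_map.
by apply: eq_big_seq => i /= /fE[a _ <-]; rewrite numulA ee.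
Qed.

Variable eta : algAut A.

Lemma twist_ract_unital (x : A) : exists s : seq (A * A),
  x = \sum_(p <- s) p.1 ** eta p.2.
Proof.
have [eta' _ eta'K] := alg_aut_bij eta.
have [s ->] := numul_unitall x; exists [seq (p.1, eta' p.2) | p <- s].
by rewrite big_map; apply: eq_bigr => p _; rewrite /= eta'K.
Qed.

(* The bimodule {}_1 A_eta. *)
Definition twist : bimodule A.
Proof.
refine (@Bimodule K A A (fun a x => a ** x) (fun x b => x ** eta b)
          _ _ _ _ _ _ _ numul_unitall twist_ract_unital).
- exact: numul_linearl.
- exact: numul_linearr.
- by move=> b; apply: numul_linearl.
- by move=> x c a b; rewrite alg_aut_linear numul_linearr.
- by move=> a b x; rewrite numulA.
- by move=> x a b; rewrite alg_autM numulA.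
- by move=> a x b; rewrite numulA.
Defined.

End Twist.

Definition gr_twist {K : fieldType} {H : zmodType} {A : eiGrAlgType K H}
  (eta : grAlgAut A) : grBimodule A.
Proof.
refine (@GrBimodule K H A (twist eta) (@hcomp K H A) (@hcomp_subspace K H A)
          (@hcomp_direct K H A) (@hcompM K H A) _).
by move=> h k x a xh ak; apply: hcompM => //; apply: gr_alg_autP.
Defined.

Section Shift.
Context {K : fieldType} {H : zmodType} {A : grAlgType K H}.
Variables (M : grBimodule A) (k : H).

Lemma shift_direct : is_direct_sum (fun h => @gr_comp K H A M (k + h)) setT.
Proof.
have [sM iM] := gr_comp_direct M; split.
  apply/seteqP; split=> // x _; have : sum_of (@gr_comp K H A M) x by rewrite sM.
  move=> [s [f [fM ->]]]; exists [fset (t - k)%R | t in s]%fset, (fun h => f (k + h)).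
  split=> [_ /imfsetP[t /= ts ->]|]; first by rewrite addrC subrK; apply: fM.
  rewrite big_imfset /=; last by move=> t u _ _; apply: addIr.
  by apply: eq_bigr => t _; rewrite addrC subrK.
move=> s f fM f0 t ts.
pose g h := f (h - k); have gE u : g (k + u) = f u by rewrite /g addrAC subrr add0r.
have /(_ _ _ (k + t)) := iM [fset (k + h)%R | h in s]%fset g.
rewrite gE; apply=> [_ /imfsetP[h /= hs ->]||]; first by rewrite gE; apply: fM.
  rewrite big_imfset /=; last by move=> u v _ _; apply: addrI.
  by rewrite -[RHS]f0; apply: eq_bigr => u _; rewrite gE.
by apply/imfsetP; exists t.
Qed.

(* M[k]_h = M_(k + h) *)
Definition gr_shift : grBimodule A.
Proof.
refine (@GrBimodule K H A M (fun h => @gr_comp K H A M (k + h))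
          (fun h => gr_comp_subspace M (k + h)) shift_direct _ _).
- by move=> h l a m ah ml; rewrite addrCA; apply: gr_comp_lact.
- by move=> h l m a mh al; rewrite addrA; apply: gr_comp_ract.
Defined.

End Shift.

Section PseudoFrobenius.
Context {K : fieldType} {H : zmodType} {A : grAlgType K H}.

Definition is_graded_left_ideal (L : set A) : Prop :=
  [/\ subspace L,
      (forall a x, L x -> L (a ** x)) &
      is_direct_sum (fun h : H => L `&` hcomp h) L].

Definition is_maximal_graded_left_ideal (L : set A) : Prop :=
  [/\ is_graded_left_ideal L, L <> setT &
      forall L', is_graded_left_ideal L' -> L `<=` L' -> L' = L \/ L' = setT].

Definition gr_Jacobson_radical : set A :=
  [set x | forall L, is_maximal_graded_left_ideal L -> L x].

(* A subring R of A with identity u is local when u is nonzero and the set of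
   non-invertible elements of R is closed under addition. *)
Definition invertible_in (R : set A) (u x : A) : Prop :=
  exists y, [/\ R y, x ** y = u & y ** x = u].

Definition is_local (R : set A) (u : A) : Prop :=
  u <> 0 /\ forall x y, R x -> R y ->
    ~ invertible_in R u x -> ~ invertible_in R u y -> ~ invertible_in R u (x + y).

(* D(V) for a graded subspace V of A: an element of the direct sum over h of
   the Hom_K(V_h, K) is a linear form on V vanishing on V_h for almost all h.
   Such forms are represented by functions on A, up to equality on V. *)
Definition graded_dual (V : set A) : set (A -> K) :=
  [set f | (forall a u v, V u -> V v -> f (a *: u + v) = a * f u + f v) /\
     finite_set [set h : H | exists2 v, (V `&` hcomp h) v & f v <> 0]].

Definition form_of_degree (B : {biscalar A}) (V W : set A) (d : H) : Prop :=
  forall h k v w, (V `&` hcomp h) v -> (W `&` hcomp k) w -> B v w <> 0 ->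
    h + k = d.

(* The induced maps W -> D(V) and V -> D(W) are well defined and bijective. *)
Definition nondegenerate_on (B : {biscalar A}) (V W : set A) : Prop :=
  [/\ (forall w, W w -> graded_dual V (B^~ w)),
      (forall f, graded_dual V f ->
         exists! w, W w /\ forall v, V v -> B v w = f v),
      (forall v, V v -> graded_dual W (B v)) &
      (forall f, graded_dual W f ->
         exists! v, V v /\ forall w, W w -> B v w = f w)].

Section Families.
Context {I : choiceType}.
Variable e : dfamily A I.

Definition locally_finite_dim : Prop :=
  forall i j (h : H), finite_dim (corner e i j (hcomp h)).

Definition weakly_basic : Prop :=
  (forall i, is_local (corner e i i (hcomp (0 : H))) (e i)) /\
  (forall i j, i <> j -> corner e i j setT `<=` gr_Jacobson_radical).

(* B is a graded Nakayama form with respect to e, with associated permutation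
   nu and degree map d. *)
Record graded_Nakayama_form (B : {biscalar A}) (nu : I -> I) (d : I -> H)
    : Prop := {
  Nakayama_assoc : forall a b c, B (a ** b) c = B a (b ** c);
  Nakayama_perm : forall i j,
    (exists a b, B (e i ** a) (b ** e j) <> 0) <-> j = nu i;
  Nakayama_bij : bijective nu;
  Nakayama_degree : forall i j,
    form_of_degree B (corner e i j setT) (corner e j (nu i) setT) (d i);
  Nakayama_nondeg : forall i j,
    nondegenerate_on B (corner e i j setT) (corner e j (nu i) setT)
}.

End Families.

Definition graded_pseudo_Frobenius : Prop :=
  exists (I : choiceType) (e : dfamily A I),
    [/\ locally_finite_dim e, weakly_basic e &
        exists B nu d, graded_Nakayama_form e B nu d].

End PseudoFrobenius.
Arguments graded_pseudo_Frobenius {K H} A.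

Definition permutes_family {I A : Type} (e : I -> A) (eta : A -> A) : Prop :=
  exists2 sigma : I -> I, bijective sigma & forall i, eta (e i) = e (sigma i).

(* Main.v *)
Require Import Defs.
From HB Require Import structures.
From mathcomp Require Import all_boot all_order all_algebra.
From mathcomp Require Import finmap sesquilinear.
From mathcomp Require Import boolp classical_sets functions cardinality.

Set Implicit Arguments.
Unset Strict Implicit.
Unset Printing Implicit Defensive.

Import GRing.Theory.

Local Open Scope classical_set_scope.
Local Open Scope ring_scope.

(** A Nakayama form pairs every corner e_i A e_j perfectly with
    e_j A e_(nu i) and trivially with every other corner.  Each element of
    D(A) lives on finitely many corners, so the blockwise perfection adds up:
    every f in D(A) is B(-, x) for exactly one x, and B(x', -) for exactly one
    x' (form_represents_r, form_separated_r and their left-hand versions).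
    Hence x |-> B(-, x) identifies A with D(A), and there is a unique linear
    bijection eta with B(y, eta x) = B(x, y) for all x and y.  Associativity of
    B makes eta multiplicative, and makes x |-> B(-, x) a bimodule map from
    {}_1 A_eta to D(A).  The block structure yields eta(e_i) = e_(nu i).
    Comparing degrees, eta shifts the degree on e_i A e_j by d(j) - d(i): it
    preserves homogeneity on corners, and preserves degrees when d is constant,
    in which case the inverse isomorphism D(A) -> A shifts degrees by that
    constant.

    For the first assertion the Nakayama form at hand is attached to some
    weakly basic family (f_j), possibly different from (e_i), and has to be
    moved to (e_i).  This is the Krull-Schmidt exchange argument in terms of
    idempotents.  Writing e_i as a finite sum of the e_i f_j e_i and using that
    e_i A_0 e_i is local, some e_i f_j e_i is invertible, which produces u_i in
    e_i A_0 f_j and v_i in f_j A_0 e_i with u_i v_i = e_i and v_i u_i = f_j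
    (idem_equiv_exists).  The index j determines i, for otherwise e_i would lie
    in the graded Jacobson radical, whereas an explicit maximal graded left
    ideal omits it (local_idempotent_not_in_radical, idem_equiv_unique).  So
    i |-> j is a bijection, the maps x |-> v_i x u_k on the corners e_i A e_k
    assemble into an automorphism phi of A carrying (e_i) to (f_j)
    (conjugation_exists), and B(phi x, phi y) is a Nakayama form for (e_i)
    (Nakayama_form_transport). *)

(** * Linear maps and sums of subspaces *)

Section LinearMaps.
Context {K : fieldType} {U V : lmodType K}.

Lemma linear_map0 (f : U -> V) : linear f -> f 0 = 0.
Proof.
by move=> fL; have := fL (-1) 0 0; rewrite !scaleN1r !addNr.
Qed.

Lemma linear_mapD (f : U -> V) : linear f -> {morph f : x y / x + y}.
Proof. by move=> fL x y; rewrite -[x]scale1r fL !scale1r. Qed.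

Lemma linear_map_inv (f : U -> V) (g : V -> U) :
  cancel f g -> cancel g f -> linear f -> linear g.
Proof.
by move=> fK gK fL c x y; rewrite -[x in LHS]gK -[y in LHS]gK -fL fK.
Qed.

End LinearMaps.

Section ScalarMaps.
Context {K : fieldType} {U : lmodType K}.

Lemma scalar_map0 (f : U -> K) : scalar f -> f 0 = 0.
Proof. exact: (@linear_map0 K U K^o). Qed.

Lemma scalar_mapD (f : U -> K) : scalar f -> {morph f : x y / x + y}.
Proof. exact: (@linear_mapD K U K^o). Qed.

Lemma scalar_map_sum (T : Type) (s : seq T) (F : T -> U) (f : U -> K) :
  scalar f -> f (\sum_(t <- s) F t) = \sum_(t <- s) f (F t).
Proof.
by move=> fL; apply: (big_morph f (scalar_mapD fL) (scalar_map0 fL)).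
Qed.

Lemma scalar_mapB (f : U -> K) : scalar f -> {morph f : x y / x - y}.
Proof.
by move=> fL x y; rewrite addrC -scaleN1r fL mulN1r addrC.
Qed.

End ScalarMaps.

(** The two summands may be spread over different finite index sets, so both
    families are first extended by zero to the union. *)
Lemma sum_ofD (K : fieldType) (M : lmodType K) (T : choiceType) (V : T -> set M) x y :
    (forall t, subspace (V t)) ->
  sum_of V x -> sum_of V y -> sum_of V (x + y).
Proof.
move=> V_sub; have V0 t : V t 0 by have /subspaceP[] := V_sub t.
have VD t u v : V t u -> V t v -> V t (u + v).
  have /subspaceP[_ VL] := V_sub t; move=> Vu Vv.
  by rewrite -[u]scale1r; apply: VL.
move=> [s [f [fV ->]]] [s' [f' [fV' ->]]].
pose ext (r : {fset T}) (g : T -> M) t := if t \in r then g t else 0.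
have extE r r' g : (r `<=` r')%fset ->
    \sum_(t <- r) g t = \sum_(t <- r') ext r g t.
  move=> rr'; rewrite -(big_fset_incl _ rr') => [|t _ /negbTE tr].
    by apply: eq_big_seq => t tr; rewrite /ext tr.
  by rewrite /ext tr.
exists (s `|` s')%fset, (fun t => ext s f t + ext s' f' t); split=> [t _|].
  by apply: VD; rewrite /ext; case: ifP => // tr; [apply: fV | apply: fV'].
by rewrite big_split /=; congr (_ + _); apply: extE; rewrite ?fsubsetUl ?fsubsetUr.
Qed.

(** * Block-perfect pairings *)

Section BlockPairing.
Context {K : fieldType} {A : lmodType K} {T : choiceType}.
Variables (B : A -> A -> K) (C : T -> set A) (p : T -> T).
Hypothesis Bl : forall y, scalar (B^~ y).
Hypothesis Br : forall x, scalar (B x).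
Hypothesis C_span : sum_of C = setT.
Hypothesis p_bij : bijective p.
Hypothesis B_block : forall t u v w, C t v -> C u w -> B v w <> 0 -> u = p t.

Lemma scalar_ext (f g : A -> K) : scalar f -> scalar g ->
  (forall t v, C t v -> f v = g v) -> f =1 g.
Proof.
move=> fL gL fg x; have : sum_of C x by rewrite C_span.
move=> [s [c [cC ->]]]; rewrite !scalar_map_sum //.
by apply: eq_big_seq => t ts; apply: fg (cC t ts).
Qed.

(** Testing x against C t isolates its component in C (p t). *)
Lemma block_separated x :
    (forall t w, C (p t) w -> (forall v, C t v -> B v w = 0) -> w = 0) ->
  (forall y, B y x = 0) -> x = 0.
Proof.
move=> Bsep; have : sum_of C x by rewrite C_span.
move=> [s [c [cC ->]]] Bx; rewrite big_seq big1 // => u us.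
have [q pK qK] := p_bij; have := cC u us; rewrite -[u in C u]qK => cu.
apply: (Bsep _ _ cu) => v Cv; have := Bx v.
rewrite (scalar_map_sum _ _ (Br v)) (big_fsetD1 u) //= big_seq big1 ?addr0 //.
move=> u'; rewrite !inE => /andP[/eqP uu' u's].
by apply: contrapT => /(B_block Cv (cC u' u's)); rewrite qK.
Qed.

(** The representing vectors of the restrictions of f to the blocks add up to
    one of f; finiteness of the support of f makes the sum meaningful. *)
Lemma block_represented (f : A -> K) : scalar f ->
    finite_set [set t | exists2 v, C t v & f v <> 0] ->
    (forall t, exists w, C (p t) w /\ forall v, C t v -> B v w = f v) ->
  exists x, forall y, B y x = f y.
Proof.
move=> fL fin /choice[w wP].
exists (\sum_(t <- fset_set [set t | exists2 v, C t v & f v <> 0]) w t).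
apply: scalar_ext => // t v Cv; rewrite scalar_map_sum //.
have Bw u : u <> t -> B v (w u) = 0.
  move=> ut; apply: contrapT => /(B_block Cv (wP u).1).
  by move/(bij_inj p_bij).
have [fv|fv] := pselect (f v = 0).
  rewrite fv big1 // => u _; have [->|/eqP] := eqVneq u t; last exact: Bw.
  by rewrite (wP t).2.
rewrite (big_fsetD1 t) /=; last by rewrite in_fset_set // inE; exists v.
rewrite (wP t).2 // big_seq big1 ?addr0 // => u.
by rewrite !inE => /andP[/eqP ut _]; apply: Bw.
Qed.

End BlockPairing.

(** * Corners and homogeneous components *)

Section Corners.
Context {K : fieldType} {H : zmodType} {A : grAlgType K H} {I : choiceType}.
Variable e : dfamily A I.

Lemma left_unit_sum (x : A) : exists s : {fset I}, x = \sum_(i <- s) e i ** x.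
Proof.
have [_ _ _ _ [[sl _] _]] := dfamilyP e.
have : sum_of (fun i => [set e i ** a | a in setT]) x by rewrite sl.
move=> [s [f [fE xE]]]; exists s; rewrite [LHS]xE; apply: eq_big_seq => i si.
rewrite xE numul_sumr (big_fsetD1 i) //= big_seq big1 ?addr0 => [|j].
  by have [a _ <-] := fE i si; rewrite numulA idemE.
rewrite !inE => /andP[/eqP ji sj]; have [a _ <-] := fE j sj.
by rewrite numulA idem_orth ?numul0x //; apply/nesym.
Qed.

Lemma right_unit_sum (x : A) : exists s : {fset I}, x = \sum_(i <- s) x ** e i.
Proof.
have [_ _ _ _ [_ [sr _]]] := dfamilyP e.
have : sum_of (fun i => [set a ** e i | a in setT]) x by rewrite sr.
move=> [s [f [fE xE]]]; exists s; rewrite [LHS]xE; apply: eq_big_seq => i si.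
rewrite xE numul_suml (big_fsetD1 i) //= big_seq big1 ?addr0 => [|j].
  by have [a _ <-] := fE i si; rewrite -numulA idemE.
rewrite !inE => /andP[/eqP ji sj]; have [a _ <-] := fE j sj.
by rewrite -numulA idem_orth ?numulx0.
Qed.

Lemma corner_left i j X x : corner e i j X x -> e i ** x = x.
Proof. by case=> y _ <-; rewrite !numulA idemE. Qed.

Lemma corner_right i j X x : corner e i j X x -> x ** e j = x.
Proof. by case=> y _ <-; rewrite -!numulA idemE. Qed.

Lemma corner_intro i j (X : set A) x :
  X x -> e i ** x = x -> x ** e j = x -> corner e i j X x.
Proof. by move=> Xx ex xe; exists x => //; rewrite ex xe. Qed.

Lemma cornerT i j X x : corner e i j X x -> corner e i j setT x.
Proof. by case=> y _ <-; exists y. Qed.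

Lemma corner_subspace i j : subspace (corner e i j setT).
Proof.
apply/subspaceP; split=> [|c _ _ [x _ <-] [y _ <-]].
  by exists 0; rewrite // numulx0 numul0x.
by exists (c *: x + y); rewrite // numul_linearr numul_linearl.
Qed.

Lemma corner_span : sum_of (fun t : I * I => corner e t.1 t.2 setT) = setT.
Proof.
apply/seteqP; split=> // x _; elim/(@corner_ind _ _ _ _ e): x.
- by exists fset0, (fun=> 0); rewrite big_seq_fset0; split.
- by move=> x y; apply: sum_ofD => t; apply: corner_subspace.
- move=> i j h x /cornerT xc; exists [fset (i, j)]%fset, (fun=> x).
  by rewrite big_seq_fset1; split=> // t; rewrite inE => /eqP->.
Qed.

Lemma corner_idem i : corner e i i setT (e i).
Proof. by exists (e i); rewrite ?idemE. Qed.

Lemma corner_idem0 i : corner e i i (hcomp (0 : H)) (e i).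
Proof. by exists (e i); rewrite ?idemE //; apply: idem_deg0. Qed.

(** Degree-wise refinement of corner_ind: the idempotents have degree 0, so
    cutting x into corners does not change its degree. *)
Lemma hcomp_corner_ind (P : A -> Prop) h :
    P 0 -> (forall x y, P x -> P y -> P (x + y)) ->
    (forall i j x, corner e i j (hcomp h) x -> P x) ->
  forall x, hcomp (h : H) x -> P x.
Proof.
move=> P0 PD Pc x xh; have [s ->] := left_unit_sum x.
apply: big_ind => // i _; have [s' ->] := right_unit_sum (e i ** x).
by apply: big_ind => // j _; apply: (Pc i j); exists x.
Qed.

Lemma corner_ext x y :
  (forall i j, e i ** x ** e j = e i ** y ** e j) -> x = y.
Proof.
move=> exy; apply/eqP; rewrite -subr_eq0; apply/eqP.
have exy0 i j : e i ** (x - y) ** e j = 0.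
  by rewrite addrC -scaleN1r numul_linearr numul_linearl exy scaleN1r addNr.
have [s ->] := left_unit_sum (x - y); rewrite big1 // => i _.
by have [s' ->] := right_unit_sum (e i ** (x - y)); rewrite big1.
Qed.

End Corners.

Section Components.
Context {K : fieldType} {H : zmodType} {A : grAlgType K H}.

Definition homogeneous_projections (pi : H -> A -> A) : Prop :=
  [/\ forall t, linear (pi t), forall t x, hcomp t (pi t x),
      forall t x, hcomp t x -> pi t x = x,
      forall t u x, hcomp u x -> u <> t -> pi t x = 0
    & forall x, exists s : {fset H},
        (forall t, t \notin s -> pi t x = 0) /\ x = \sum_(t <- s) pi t x].

Lemma homogeneous_projections_exist : exists pi, homogeneous_projections pi.
Proof. exact: (direct_sum_proj (@hcomp_subspace K H A) (@hcomp_direct K H A)). Qed.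

Variable pi : H -> A -> A.
Hypothesis piP : homogeneous_projections pi.

Lemma proj_sum (T : Type) (s : seq T) (F : T -> A) t :
  pi t (\sum_(k <- s) F k) = \sum_(k <- s) pi t (F k).
Proof.
have [piL _ _ _ _] := piP.
exact: (big_morph (pi t) (linear_mapD (piL t)) (linear_map0 (piL t))).
Qed.

Lemma projMl s b t x : hcomp s b -> pi t (b ** x) = b ** pi (t - s) x.
Proof.
have [piL piV pi_id pi0 pi_sum] := piP; move=> bs; have [r [_ ->]] := pi_sum x.
rewrite numul_sumr !proj_sum numul_sumr; apply: eq_bigr => k _.
have bk : hcomp (s + k) (b ** pi k x) by apply: hcompM.
have [kt|kt] := pselect (k = t - s).
  have -> : t = s + k by rewrite kt addrC subrK.
  by rewrite [s + k - s]addrC addKr (pi_id _ _ bk) (pi_id k (pi k x)).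
rewrite (pi0 (t - s) k) // numulx0; apply: (pi0 t (s + k)) => // skt.
by apply: kt; rewrite -skt addrC addKr.
Qed.

Lemma projMr0 c t x : hcomp (0 : H) c -> pi t (x ** c) = pi t x ** c.
Proof.
have [piL piV pi_id pi0 pi_sum] := piP; move=> c0; have [r [_ ->]] := pi_sum x.
rewrite numul_suml !proj_sum numul_suml; apply: eq_bigr => k _.
have ck : hcomp k (pi k x ** c) by rewrite -[k in hcomp k]addr0; apply: hcompM.
have [kt|kt] := pselect (k = t).
  by rewrite -kt (pi_id _ _ ck) (pi_id k (pi k x)).
by rewrite (pi0 t k) // (pi0 t k) // numul0x.
Qed.

End Components.

(** * Nakayama forms *)

Section DualForms.
Context {K : fieldType} {H : zmodType} {A : grAlgType K H} {I : choiceType}.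
Variable e : dfamily A I.

Lemma in_dual_graded_dual (f : A -> K) i j :
  in_dual e f -> graded_dual (corner e i j setT) f.
Proof.
move=> [fL fS]; split=> [a u v _ _|]; first exact: fL.
apply: sub_finite_set (finite_image snd fS) => h [v [vc vh] fv].
exists (i, j, h) => //; exists v => //.
exact: corner_intro vh (corner_left vc) (corner_right vc).
Qed.

Lemma in_dual_finite_corners (f : A -> K) : in_dual e f ->
  finite_set [set t : I * I | exists2 v, corner e t.1 t.2 setT v & f v <> 0].
Proof.
move=> [fL fS]; apply: sub_finite_set (finite_image fst fS).
move=> [i j] /= [v vc fv]; apply: contrapT => nS; apply: fv.
have : sum_of hcomp v by have [-> _] := @hcomp_direct K H A.
move=> [s [g [gh vE]]].
rewrite -(corner_right vc) -(corner_left vc) vE numul_sumr numul_suml.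
rewrite scalar_map_sum // big_seq big1 // => h /gh gc; apply: contrapT => fg.
by apply: nS; exists (i, j, h) => //; exists (e i ** g h ** e j) => //; exists (g h).
Qed.

End DualForms.

Section NakayamaForm.
Context {K : fieldType} {H : zmodType} {A : grAlgType K H} {I : choiceType}.
Variables (e : dfamily A I) (B : {biscalar A}) (nu : I -> I) (d : I -> H).
Hypothesis BN : graded_Nakayama_form e B nu d.

Lemma form_linearl y : scalar (B^~ y).
Proof. by move=> c x x'; rewrite linearPl. Qed.

Lemma form_linearr x : scalar (B x).
Proof. by move=> c y y'; rewrite linearPr. Qed.

(** Associativity forces the inner indices of a nonzero product to agree, and
    the definition of nu then forces the outer ones to correspond. *)
Lemma form_block i j k l v w : corner e i j setT v -> corner e k l setT w ->
  B v w <> 0 -> k = j /\ l = nu i.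
Proof.
move=> vc wc Bvw; split; last first.
  apply/(Nakayama_perm BN); exists v, w.
  by rewrite (corner_left vc) (corner_right wc).
apply: contrapT => kj; apply: Bvw.
rewrite -(corner_right vc) (Nakayama_assoc BN) -(corner_left wc) numulA.
by rewrite idem_orth ?numul0x ?(scalar_map0 (form_linearr _)) //; apply/nesym.
Qed.

Lemma corner_shift_bij : bijective (fun t : I * I => (t.2, nu t.1)).
Proof.
have [mu nuK muK] := Nakayama_bij BN.
by exists (fun t => (mu t.2, t.1)) => -[i j] /=; rewrite ?nuK ?muK.
Qed.

Lemma corner_dual0 i j : graded_dual (corner e i j setT) (fun=> 0 : K).
Proof.
split=> [a u v _ _|]; first by rewrite mulr0 addr0.
by apply: (@sub_finite_set _ _ set0) => // h [x _]; case.
Qed.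

Lemma form_separated_r x : (forall y, B y x = 0) -> x = 0.
Proof.
apply: (block_separated form_linearr (corner_span e) corner_shift_bij).
  move=> [i j] [k l] v w /= vc wc /(form_block vc wc)[-> ->] //.
move=> [i j] w /= wc Bw.
have [_ /(_ _ (corner_dual0 i j))[z [_ zuniq]] _ _] := Nakayama_nondeg BN i j.
rewrite -(zuniq w) //; apply: zuniq; split.
  by have /subspaceP[] := corner_subspace e j (nu i).
by move=> v _; rewrite (scalar_map0 (form_linearr _)).
Qed.

Lemma form_represents_r (f : A -> K) : in_dual e f ->
  exists x, forall y, B y x = f y.
Proof.
move=> fD.
apply: (block_represented form_linearl form_linearr (corner_span e) corner_shift_bij).
- by move=> [i j] [k l] v w /= vc wc /(form_block vc wc)[-> ->].
- by case: fD.
- exact: in_dual_finite_corners.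
move=> [i j] /=; have [_ + _ _] := Nakayama_nondeg BN i j.
by move=> /(_ _ (in_dual_graded_dual i j fD))[w [wP _]]; exists w.
Qed.

(** The left-hand versions apply the block argument to the transposed form,
    with the inverse reindexing of corners; mu is the inverse of nu. *)
Lemma form_left_corner (mu : I -> I) : cancel mu nu ->
  forall t u : I * I, forall v w, corner e t.1 t.2 setT v ->
  corner e u.1 u.2 setT w -> B w v <> 0 -> u = (mu t.2, t.1).
Proof.
have [nu' nuK _] := Nakayama_bij BN.
move=> muK [i j] [k l] v w /= vc wc /(form_block wc vc)[-> ->].
by congr (_, _); apply: (can_inj nuK); rewrite muK.
Qed.

Lemma form_separated_l x : (forall y, B x y = 0) -> x = 0.
Proof.
have [mu nuK muK] := Nakayama_bij BN.
apply: (@block_separated K A _ (fun v w => B w v) _ (fun t => (mu t.2, t.1))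
  form_linearl (corner_span e) _ (form_left_corner muK)).
  by exists (fun t => (t.2, nu t.1)) => -[i j] /=; rewrite ?nuK ?muK.
move=> [i j] w /= wc Bw; have := Nakayama_nondeg BN (mu j) i.
rewrite muK => -[_ _ _ /(_ _ (corner_dual0 _ _))[z [_ zuniq]]].
rewrite -(zuniq w) //; apply: zuniq; split.
  by have /subspaceP[] := corner_subspace e (mu j) i.
by move=> v _; rewrite (scalar_map0 (form_linearl _)).
Qed.

Lemma form_represents_l (f : A -> K) : in_dual e f ->
  exists x, forall y, B x y = f y.
Proof.
move=> fD; have [mu nuK muK] := Nakayama_bij BN.
apply: (@block_represented K A _ (fun v w => B w v) _ (fun t => (mu t.2, t.1))
  form_linearr form_linearl (corner_span e) _ (form_left_corner muK)).
- by exists (fun t => (t.2, nu t.1)) => -[i j] /=; rewrite ?nuK ?muK.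
- by case: fD.
- exact: in_dual_finite_corners.
move=> [i j] /=; have := Nakayama_nondeg BN (mu j) i.
rewrite muK => -[_ _ _ /(_ _ (in_dual_graded_dual _ _ fD))[w [wP _]]].
by exists w.
Qed.

Lemma form_degree i j k l h t v w :
  corner e i j (hcomp h) v -> corner e k l (hcomp t) w -> B v w <> 0 ->
  h + t = d i.
Proof.
move=> vc wc Bvw; have [kj lnu] := form_block (cornerT vc) (cornerT wc) Bvw.
subst k l; apply: (Nakayama_degree BN (conj (cornerT vc) (corner_hcomp vc))
  (conj (cornerT wc) (corner_hcomp wc)) Bvw).
Qed.

Lemma form_in_dual_r x : in_dual e (B^~ x).
Proof.
split; first exact: form_linearl.
have [mu nuK muK] := Nakayama_bij BN.
elim/(@corner_ind _ _ _ _ e): x => [|x y fx fy|k l t x xc].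
- apply: (@sub_finite_set _ _ set0) => // t [x _]; case.
  by rewrite (scalar_map0 (form_linearr _)).
- apply: (@sub_finite_set _ _ (dual_supp e (B^~ x) `|` dual_supp e (B^~ y))).
    move=> t [v vc Bv]; have [Bvx|Bvx] := pselect (B v x = 0); last by left; exists v.
    right; exists v => // Bvy; apply: Bv.
    by rewrite (scalar_mapD (form_linearr _)) Bvx Bvy addr0.
  by rewrite finite_setU.
- apply: (@sub_finite_set _ _ [set (mu l, k, d (mu l) - t)]) => //.
  move=> [[i j] h] [v vc Bv].
  have [kj lnu] := form_block (cornerT vc) (cornerT xc) Bv.
  by rewrite /= kj lnu nuK -(form_degree vc xc Bv) addrK.
Qed.

Lemma form_in_dual_l x : in_dual e (B x).
Proof.
split; first exact: form_linearr.
elim/(@corner_ind _ _ _ _ e): x => [|x y fx fy|k l t x xc].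
- apply: (@sub_finite_set _ _ set0) => // t [x _]; case.
  by rewrite (scalar_map0 (form_linearl _)).
- apply: (@sub_finite_set _ _ (dual_supp e (B x) `|` dual_supp e (B y))).
    move=> t [v vc Bv]; have [Bvx|Bvx] := pselect (B x v = 0); last by left; exists v.
    right; exists v => // Bvy; apply: Bv.
    by rewrite (scalar_mapD (form_linearl _)) Bvx Bvy addr0.
  by rewrite finite_setU.
- apply: (@sub_finite_set _ _ [set (l, nu k, d k - t)]) => //.
  move=> [[i j] h] [v vc Bv].
  have /=[il jnu] := form_block (cornerT xc) (cornerT vc) Bv.
  by rewrite /= il jnu -(form_degree xc vc Bv) addrC addKr.
Qed.

Lemma form_inj_r x y : (forall z, B z x = B z y) -> x = y.
Proof.
move=> Bxy; apply/eqP; rewrite -subr_eq0; apply/eqP/form_separated_r => z.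
by rewrite (scalar_mapB (form_linearr z)) Bxy subrr.
Qed.

Lemma form_inj_l x y : (forall z, B x z = B y z) -> x = y.
Proof.
move=> Bxy; apply/eqP; rewrite -subr_eq0; apply/eqP/form_separated_l => z.
by rewrite (scalar_mapB (form_linearl z)) Bxy subrr.
Qed.

(** A nonzero component of z in a degree t <> s would be detected by some
    homogeneous y in a corner; for degree reasons y sees that component only,
    so B y z is nonzero and the hypothesis contradicts t <> s. *)
Lemma form_homogeneous z s :
    (forall k l u y, corner e k l (hcomp u) y -> B y z <> 0 -> u + s = d k) ->
  hcomp s z.
Proof.
move=> Bz; have [pi [piL piV _ _ pi_sum]] := @homogeneous_projections_exist K H A.
have Bpi k l u t y x : corner e k l (hcomp u) y -> hcomp t x -> B y x <> 0 ->
    u + t = d k.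
  move=> yc xt; apply: contra_notP => ut.
  elim/(@hcomp_corner_ind _ _ _ _ e): xt => [|x' x'' Bx' Bx''|i j x' xc].
  - by rewrite (scalar_map0 (form_linearr _)).
  - by rewrite (scalar_mapD (form_linearr _)) Bx' Bx'' addr0.
  - by apply: contrapT => /(form_degree yc xc).
have Byz k l u y : corner e k l (hcomp u) y -> B y z = B y (pi (d k - u) z).
  move=> yc; have [r [r0 zE]] := pi_sum z.
  have pi0 t : t <> d k - u -> B y (pi t z) = 0.
    move=> tu; apply: contrapT => /(Bpi _ _ _ _ _ _ yc (piV t z)) ut.
    by apply: tu; rewrite -ut addrC addKr.
  rewrite [in LHS]zE (scalar_map_sum _ _ (form_linearr y)).
  have [ur|ur] := boolP (d k - u \in r); last first.
    rewrite r0 // (scalar_map0 (form_linearr y)) big_seq big1 // => t tr.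
    by apply: pi0 => tu; rewrite -tu tr in ur.
  rewrite (big_fsetD1 (d k - u)) //= big_seq big1 ?addr0 // => t.
  by rewrite !inE => /andP[/eqP tu _]; apply: pi0.
have pi0 t : t <> s -> pi t z = 0.
  move=> ts; apply: form_separated_r.
  elim/(@corner_ind _ _ _ _ e) => [|x y Bx By|k l u y yc].
  - by rewrite (scalar_map0 (form_linearl _)).
  - by rewrite (scalar_mapD (form_linearl _)) Bx By addr0.
  - apply: contrapT => Bpiz; have ut := Bpi _ _ _ _ _ _ yc (piV t z) Bpiz.
    have := Byz _ _ _ _ yc; rewrite -ut [u + t]addrC addrK => Bpi'.
    rewrite -Bpi' in Bpiz; have := Bz _ _ _ _ yc Bpiz; rewrite -ut.
    by move/addrI/esym.
have [r [r0 zE]] := pi_sum z; have [sr|sr] := boolP (s \in r).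
  rewrite zE (big_fsetD1 s) //= big_seq big1 ?addr0 // => t.
  by rewrite !inE => /andP[/eqP ts _]; apply: pi0.
rewrite zE big_seq big1 => [|t tr]; first exact: hcomp0.
by apply: pi0 => ts; rewrite -ts tr in sr.
Qed.

End NakayamaForm.

(** * The Nakayama automorphism *)

Section NakayamaAutomorphism.
Context {K : fieldType} {H : zmodType} {A : eiGrAlgType K H} {I : choiceType}.
Variables (e : dfamily A I) (B : {biscalar A}) (nu : I -> I) (d : I -> H).
Hypothesis BN : graded_Nakayama_form e B nu d.

(** Multiplicativity rotates the arguments twice:
    B(y, eta(x x')) = B(x, x' y) = B(x', y eta x) = B(y, eta x eta x').
    The inverse of eta comes from representing the forms B(-, x) on the left. *)
Lemma Nakayama_aut : exists eta : algAut A, forall x y, B y (eta x) = B x y.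
Proof.
have /choice[eta etaP] x : exists x', forall y, B y x' = B x y.
  exact: (form_represents_r BN (form_in_dual_l BN x)).
have /choice[theta thetaP] x : exists x', forall y, B x' y = B y x.
  exact: (form_represents_l BN (form_in_dual_r BN x)).
have etaL : linear eta.
  move=> c x x'; apply: (form_inj_r BN) => y.
  by rewrite etaP form_linearl form_linearr !etaP.
have etaM : {morph eta : x y / x ** y}.
  move=> x x'; apply: (form_inj_r BN) => y.
  rewrite etaP (Nakayama_assoc BN) -etaP (Nakayama_assoc BN) -etaP.
  by rewrite !(Nakayama_assoc BN).
have eta_bij : bijective eta.
  exists theta => x; first by apply: (form_inj_l BN) => y; rewrite thetaP etaP.
  by apply: (form_inj_r BN) => y; rewrite etaP thetaP.
by exists (AlgAut etaL etaM eta_bij).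
Qed.

Variable eta : algAut A.
Hypothesis etaP : forall x y, B y (eta x) = B x y.

(** For y in a corner, both B(e_i, y) and B(y, e_(nu i)) vanish unless that
    corner is e_i A e_(nu i), where associativity identifies them. *)
Lemma Nakayama_aut_idem i : eta (e i) = e (nu i).
Proof.
apply: (form_inj_r BN) => y; rewrite etaP.
elim/(@corner_ind _ _ _ _ e): y => [|x y Bx By|k l u y yc].
- by rewrite (scalar_map0 (form_linearl B _)) (scalar_map0 (form_linearr B _)).
- by rewrite (scalar_mapD (form_linearr B _)) (scalar_mapD (form_linearl B _)) Bx By.
have Bl : B (e i) y <> 0 -> k = i /\ l = nu i.
  exact: (form_block BN (corner_idem e i) (cornerT yc)).
have Br : B y (e (nu i)) <> 0 -> k = i /\ l = nu i.
  move=> /(form_block BN (cornerT yc) (corner_idem e _))[<-].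
  by move=> /(bij_inj (Nakayama_bij BN))->.
have [[ki lnu]|nkl] := pselect (k = i /\ l = nu i); last first.
  by rewrite [LHS](contrapT (nkl \o Bl)) [RHS](contrapT (nkl \o Br)).
subst k l; rewrite -[in RHS](corner_left yc) (Nakayama_assoc BN).
by rewrite (corner_right yc).
Qed.

Lemma Nakayama_aut_homogeneous i j x :
  corner e i j setT x -> homogeneous x -> homogeneous (eta x).
Proof.
move=> xc [t xt]; exists (t + d j - d i).
have {}xt : corner e i j (hcomp t) x.
  exact: corner_intro xt (corner_left xc) (corner_right xc).
apply: (form_homogeneous BN) => k l u y yc; rewrite etaP => Bxy.
have [-> _] := form_block BN xc (cornerT yc) Bxy.
by rewrite -(form_degree BN xt yc Bxy) !addrA [u + t]addrC [_ + d j]addrC addrK.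
Qed.

Lemma form_dual_subproof x : (B^~ x : A -> K^o) \in dual_pred e.
Proof. exact/asboolP/(form_in_dual_r BN). Qed.

Definition form_dual (x : A) : dual e := Dual (form_dual_subproof x).

Lemma form_dual_iso : is_bimodule_iso
  (form_dual : twist eta -> dual_bimodule e).
Proof.
split.
- by move=> c x y; apply: dual_eq => z /=; rewrite form_linearr.
- by move=> a x; apply: dual_eq => z /=; rewrite (Nakayama_assoc BN).
- move=> x a; apply: dual_eq => z /=.
  by rewrite -(Nakayama_assoc BN) etaP (Nakayama_assoc BN).
have /choice[g gP] (f : dual e) : exists x, forall y, B y x = f y.
  by apply: (form_represents_r BN); split; [exact: dual_linear|exact: dual_finite].
exists g => [x|f]; last by apply: dual_eq => y /=; rewrite gP.
by apply: (form_inj_r BN) => y; rewrite gP.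
Qed.

End NakayamaAutomorphism.

Lemma bimodule_iso_inv (K : fieldType) (A : nuAlgType K) (M N : bimodule A)
    (phi : M -> N) (psi : N -> M) : cancel phi psi -> cancel psi phi ->
  is_bimodule_iso phi -> is_bimodule_iso psi.
Proof.
move=> phiK psiK [phiL phil phir _]; split; last by exists phi.
- exact: linear_map_inv phiK psiK phiL.
- by move=> a n; rewrite -{1}[n]psiK -phil phiK.
- by move=> n a; rewrite -{1}[n]psiK -phir phiK.
Qed.

(** * Constant degree maps *)

Section ConstantDegree.
Context {K : fieldType} {H : zmodType} {A : eiGrAlgType K H} {I : choiceType}.
Variables (e : dfamily A I) (B : {biscalar A}) (nu : I -> I) (d : I -> H).
Hypothesis BN : graded_Nakayama_form e B nu d.
Variable h : H.
Hypothesis d_const : forall i, d i = h.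

Lemma form_degree_const t u x y :
  hcomp t x -> hcomp u y -> B x y <> 0 -> t + u = h.
Proof.
move=> xt yu; apply: contra_notP => tu.
elim/(@hcomp_corner_ind _ _ _ _ e): xt => [|x' x'' Bx' Bx''|i j x' xc].
- by rewrite (scalar_map0 (form_linearl B _)).
- by rewrite (scalar_mapD (form_linearl B _)) Bx' Bx'' addr0.
elim/(@hcomp_corner_ind _ _ _ _ e): yu => [|y' y'' By' By''|k l y' yc].
- by rewrite (scalar_map0 (form_linearr B _)).
- by rewrite (scalar_mapD (form_linearr B _)) By' By'' addr0.
by apply: contrapT => /(form_degree BN xc yc); rewrite d_const.
Qed.

Lemma Nakayama_aut_graded (eta : algAut A) :
    (forall x y, B y (eta x) = B x y) ->
  forall t x, hcomp t x -> hcomp t (eta x).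
Proof.
move=> etaP t x xt; apply: (form_homogeneous BN) => k l u y yc.
rewrite etaP d_const addrC => Bxy.
exact: form_degree_const xt (corner_hcomp yc) Bxy.
Qed.

Lemma gr_dual_twist_iso (eta : grAlgAut A) :
    (forall x y, B y (eta x) = B x y) ->
  gr_bimodule_isomorphic (gr_dual e) (gr_shift (gr_twist eta) h).
Proof.
move=> etaP; have iso := form_dual_iso BN etaP.
have [psi phiK psiK] := bimod_iso_bij iso.
exists (psi : gr_dual e -> gr_shift (gr_twist eta) h); split.
  exact: (@bimodule_iso_inv K A (twist eta) (dual_bimodule e)
           (form_dual BN : twist eta -> dual_bimodule e) psi).
move=> t f ft; apply: (form_homogeneous BN) => k l u y yc.
have -> : B y (psi f) = (f : dual e) y by rewrite -[f in RHS]psiK.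
rewrite d_const => fy; have [->|ut] := pselect (u = - t).
  by rewrite addrCA addNr addr0.
by case: fy; apply: (ft u _ ut (corner_hcomp yc)).
Qed.

End ConstantDegree.

(** * Local idempotents and the graded radical *)

Section LocalIdempotents.
Context {K : fieldType} {H : zmodType} {A : grAlgType K H} {I : choiceType}.
Variable e : dfamily A I.

(** One of the complementary idempotents p and e_i - p is invertible, and an
    invertible idempotent is the unit e_i. *)
Lemma local_idempotent i p : is_local (corner e i i (hcomp (0 : H))) (e i) ->
  corner e i i (hcomp (0 : H)) p -> p ** p = p -> p = 0 \/ p = e i.
Proof.
set R := corner _ _ _ _; move=> [ei0 loc] pc pp.
pose q := (-1) *: p + e i.
have qc : R q.
  have /subspaceP[_ hL] := @hcomp_subspace K H A 0.
  apply: corner_intro; first exact: hL (corner_hcomp pc) (idem_deg0 e i).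
    by rewrite numul_linearr (corner_left pc) idemE.
  by rewrite numul_linearl (corner_right pc) idemE.
have [[y [yc py yp]]|np] := pselect (invertible_in R (e i) p).
  by right; rewrite -(corner_right pc) -py numulA pp.
have [[y [yc qy yq]]|nq] := pselect (invertible_in R (e i) q).
  left; rewrite -(corner_right pc) -qy numulA numul_linearr pp (corner_right pc).
  by rewrite scaleN1r addNr numul0x.
case: (loc p q pc qc np nq).
rewrite /q scaleN1r addrA subrr add0r; exists (e i).
by rewrite idemE; split=> //; apply: corner_idem0.
Qed.

(** The x such that no e_i a x_t e_i, with a of degree -t and x_t the degree t
    component of x, is invertible in e_i A_0 e_i form a maximal graded left
    ideal omitting e_i.  It is additive because the ring is local, and maximal
    because a graded left ideal not contained in it contains some z in e_i A_0
    with z e_i = e_i, hence e_i itself, while x - x e_i always lies in it. *)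
Lemma local_idempotent_not_in_radical i :
  is_local (corner e i i (hcomp (0 : H))) (e i) -> ~ gr_Jacobson_radical (e i).
Proof.
move=> [ei0 loc]; set R := corner _ _ _ _ in loc.
have [pi piP] := @homogeneous_projections_exist K H A.
have [piL piV pi_id pi0 pi_sum] := piP.
have noninv0 : ~ invertible_in R (e i) 0.
  by move=> [y [_ + _]]; rewrite numul0x => /esym.
pose N : set A := [set x | forall t a, hcomp (- t) a ->
  ~ invertible_in R (e i) (e i ** (a ** pi t x) ** e i)].
have NR t a x : hcomp (- t) a -> R (e i ** (a ** pi t x) ** e i).
  move=> ah; exists (a ** pi t x) => //.
  by rewrite -[0](addNr t); apply: hcompM.
have N_sub : subspace N.
  apply/subspaceP; split=> [t a ah|c x y Nx Ny t a ah].
    by rewrite (linear_map0 (piL t)) !numulx0 numul0x.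
  have /subspaceP[h0 hL] := @hcomp_subspace K H A (- t).
  have cah : hcomp (- t) (c *: a) by rewrite -[c *: a]addr0; apply: hL.
  rewrite piL numulDr numulZr -numulZl numulDr numulDl.
  by apply: loc; [exact: NR | exact: NR | exact: Nx | exact: Ny].
have [N0 NL] := (subspaceP N).1 N_sub.
have ND x y : N x -> N y -> N (x + y).
  by move=> Nx Ny; rewrite -[x]scale1r; apply: NL.
have N_ann x : x ** e i = 0 -> N x.
  move=> xe t a ah; rewrite -!numulA -(projMr0 piP); last exact: idem_deg0.
  by rewrite xe (linear_map0 (piL t)) !numulx0.
have N_ideal : is_graded_left_ideal N.
  split=> //.
    move=> b x Nx; have [r [_ ->]] := pi_sum b; rewrite numul_suml.
    apply: big_ind => // s _ t a ah; have bs := piV s b.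
    rewrite (projMl piP _ _ bs) [a ** _]numulA; apply: Nx.
    by rewrite opprB addrC; apply: hcompM.
  split; last first.
    move=> s f fN; have [_ ind] := @hcomp_direct K H A; apply: ind => t ts.
    by have [] := fN t ts.
  apply/seteqP; split=> [_ [s [f [fN ->]]]|x Nx].
    by rewrite big_seq; apply: big_ind => // t /fN[].
  have [s [_ xE]] := pi_sum x; exists s, (fun t => pi t x); split=> // t _.
  split=> // u a ah; have [ut|ut] := pselect (u = t).
    by rewrite ut in ah *; rewrite pi_id //; apply: Nx.
  by rewrite (pi0 u t) //; [rewrite !numulx0 numul0x|apply/nesym].
have eiN : ~ N (e i).
  move=> /(_ 0 (e i)); rewrite oppr0 => /(_ (idem_deg0 e i)); apply.
  rewrite pi_id; last exact: idem_deg0.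
  by rewrite !idemE; exists (e i); rewrite !idemE; split=> //; apply: corner_idem0.
move=> Jei; apply: (eiN); apply: Jei.
split=> // [NT|L' [L'_sub L'_mul [L'_sum _]] NL']; first by apply: eiN; rewrite NT.
have [L'0 L'L] := (subspaceP L').1 L'_sub.
have L'D x y : L' x -> L' y -> L' (x + y).
  by move=> Lx Ly; rewrite -[x]scale1r; apply: L'L.
have [sub|nsub] := pselect (L' `<=` N); first by left; apply/seteqP.
right; apply/seteqP; split=> // x0 _.
have [x [L'x [t [a [ah inv]]]]] : exists x, L' x /\ exists t a, hcomp (- t) a /\
    invertible_in R (e i) (e i ** (a ** pi t x) ** e i).
  apply: contrapT => nx; apply: nsub => x L'x t a ah inv; apply: nx.
  by exists x; split=> //; exists t, a.
have L'pi : L' (pi t x).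
  have : sum_of (fun h : H => L' `&` hcomp h) x by rewrite L'_sum.
  move=> [s [f [fE ->]]].
  rewrite (proj_sum piP) big_seq.
  apply: big_ind => // k /fE[L'f fk].
  have [<-|kt] := pselect (k = t); first by rewrite pi_id.
  by rewrite (pi0 t k).
have [y [yR _ ye]] := inv.
have L'z : L' (y ** (e i ** (a ** pi t x))) by do 3 apply: (L'_mul).
have L'ei : L' (e i).
  have -> : e i = 1 *: (y ** (e i ** (a ** pi t x))) +
      ((-1) *: (y ** (e i ** (a ** pi t x))) + e i).
    by rewrite scale1r scaleN1r addrA subrr add0r.
  apply: L'L => //; apply/NL'/N_ann.
  by rewrite numul_linearl -numulA ye idemE scaleN1r addNr.
have -> : x0 = 1 *: (x0 ** e i) + ((-1) *: (x0 ** e i) + x0).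
  by rewrite scale1r scaleN1r addrA subrr add0r.
apply: L'L; first exact: L'_mul.
by apply/NL'/N_ann; rewrite numul_linearl -numulA idemE scaleN1r addNr.
Qed.

End LocalIdempotents.

(** * Equivalent idempotents *)

Section EquivalentIdempotents.
Context {K : fieldType} {H : zmodType} {A : grAlgType K H}.

(** Degree-zero Murray-von Neumann equivalence: u and v encode mutually inverse
    isomorphisms of graded modules between A x and A y. *)
Record idem_equiv (x y u v : A) : Prop := IdemEquiv {
  idem_equiv_degl : hcomp (0 : H) u;
  idem_equiv_degr : hcomp (0 : H) v;
  idem_equiv_ul : x ** u = u;
  idem_equiv_ur : u ** y = u;
  idem_equiv_vl : y ** v = v;
  idem_equiv_vr : v ** x = v;
  idem_equiv_uv : u ** v = x;
  idem_equiv_vu : v ** u = y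
}.

Lemma idem_equiv_sym x y u v : idem_equiv x y u v -> idem_equiv y x v u.
Proof. by case. Qed.

(** In the local ring e_i A_0 e_i the unit e_i is a finite sum of the
    e_i f_j e_i, so one of these has an inverse y.  Then u = e_i f_j and
    v = f_j y satisfy u v = e_i, and v u is a nonzero idempotent of
    the local ring f_j A_0 f_j. *)
Lemma idem_equiv_exists (I J : choiceType) (e : dfamily A I) (f : dfamily A J) i :
    weakly_basic e -> weakly_basic f ->
  exists j u v, idem_equiv (e i) (f j) u v.
Proof.
move=> [e_loc _] [f_loc _]; have [ei0 loc] := e_loc i.
set R := corner _ _ _ _ in loc.
have eR x : hcomp (0 : H) x -> R (e i ** x ** e i) by move=> x0; exists x.
have [[j [y [yR ey ye]]]|nj] :=
  pselect (exists j, invertible_in R (e i) (e i ** f j ** e i)); last first.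
  have [s eE] := left_unit_sum f (e i).
  have eiE : \sum_(j <- s) e i ** (f j ** e i) = e i.
    by rewrite -numul_sumr -eE idemE.
  suff [_] : R (\sum_(j <- s) e i ** (f j ** e i)) /\
      ~ invertible_in R (e i) (\sum_(j <- s) e i ** (f j ** e i)).
    by rewrite eiE; case; exists (e i); rewrite idemE; split=> //; apply: corner_idem0.
  apply: (big_ind (fun x => R x /\ ~ invertible_in R (e i) x)).
  - split; first by exists 0; rewrite ?numulx0 ?numul0x //; apply: hcomp0.
    by move=> [y [_ + _]]; rewrite numul0x => /esym.
  - move=> x y [Rx nx] [Ry ny]; split; last exact: loc.
    apply: corner_intro.
    + by apply: hcompD; apply: corner_hcomp; eassumption.
    + by rewrite numulDr (corner_left Rx) (corner_left Ry).
    + by rewrite numulDl (corner_right Rx) (corner_right Ry).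
  - move=> j _; rewrite numulA; split; first exact/eR/idem_deg0.
    by move=> inv; apply: nj; exists j.
have yl := corner_left yR.
have [u [uE u0 ul ur]] : exists u, [/\ u = e i ** f j, hcomp (0 : H) u,
    e i ** u = u & u ** f j = u].
  exists (e i ** f j); split=> //; last by rewrite -numulA idemE.
    by rewrite -[0]addr0; apply: hcompM; apply: idem_deg0.
  by rewrite numulA idemE.
have [v [vE v0 vl vr]] : exists v, [/\ v = f j ** y, hcomp (0 : H) v,
    f j ** v = v & v ** e i = v].
  exists (f j ** y); split=> //; last by rewrite -numulA (corner_right yR).
    by rewrite -[0]addr0; apply: hcompM (corner_hcomp yR); apply: idem_deg0.
  by rewrite numulA idemE.
have uv : u ** v = e i.
  by rewrite vE numulA ur uE -{1}yl numulA.
exists j, u, v; split=> //.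
have [||vu0|//] := local_idempotent (f_loc j) (p := v ** u).
- apply: corner_intro; first by rewrite -[0]addr0; apply: hcompM.
    by rewrite numulA vl.
  by rewrite -numulA ur.
- by rewrite -numulA [u ** (v ** u)]numulA uv ul.
by case: ei0; rewrite -[LHS]idemE -uv -numulA [v ** _]numulA vu0 numul0x numulx0.
Qed.

(** If i <> i', then e_i factors through e_i' A e_i, inside the radical, and so
    lies in the radical. *)
Lemma idem_equiv_unique (I : choiceType) (e : dfamily A I) i i' y u v u' v' :
    weakly_basic e ->
  idem_equiv (e i) y u v -> idem_equiv (e i') y u' v' -> i = i'.
Proof.
move=> [e_loc e_rad] E E'; apply: contrapT => ii'.
apply: (local_idempotent_not_in_radical (e_loc i)) => L Lmax.
have [[_ L_mul _] _ _] := Lmax.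
have -> : e i = u ** v' ** (u' ** v).
  rewrite -numulA [v' ** _]numulA (idem_equiv_vu E') (idem_equiv_vl E).
  by rewrite (idem_equiv_uv E).
apply: L_mul; apply: (e_rad i' i) Lmax; first exact: nesym.
apply: corner_intro => //; first by rewrite numulA (idem_equiv_ul E').
by rewrite -numulA (idem_equiv_vr E).
Qed.

End EquivalentIdempotents.

(** * Conjugation between weakly basic families *)

Section Conjugation.
Context {K : fieldType} {H : zmodType} {A : grAlgType K H}.

Definition matching {I J : Type} (e : I -> A) (f : J -> A) (tau : I -> J)
    (u v : I -> A) : Prop :=
  bijective tau /\ forall i, idem_equiv (e i) (f (tau i)) (u i) (v i).

(** Choosing partners in both directions gives maps between I and J that are
    inverse to each other, by uniqueness of the partner. *)
Lemma matching_exists (I J : choiceType) (e : dfamily A I) (f : dfamily A J) :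
  weakly_basic e -> weakly_basic f -> exists tau u v, matching e f tau u v.
Proof.
move=> e_wb f_wb.
have /choice[t tP] i : exists t : J * A * A, idem_equiv (e i) (f t.1.1) t.1.2 t.2.
  by have [j [u [v E]]] := idem_equiv_exists i e_wb f_wb; exists (j, u, v).
have /choice[s sP] j : exists s : I * A * A, idem_equiv (f j) (e s.1.1) s.1.2 s.2.
  by have [i [u [v E]]] := idem_equiv_exists j f_wb e_wb; exists (i, u, v).
exists (fun i => (t i).1.1), (fun i => (t i).1.2), (fun i => (t i).2).
split=> //; exists (fun j => (s j).1.1) => [i|j].
  by apply/esym; apply: (idem_equiv_unique e_wb (tP i) (idem_equiv_sym (sP _))).
by apply/esym; apply: (idem_equiv_unique f_wb (sP j) (idem_equiv_sym (tP _))).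
Qed.

Lemma matching_sym (I J : Type) (e : I -> A) (f : J -> A) tau sigma u v :
    cancel tau sigma -> cancel sigma tau -> matching e f tau u v ->
  matching f e sigma (v \o sigma) (u \o sigma).
Proof.
move=> tauK sigmaK [_ E]; split; first by exists tau.
by move=> j; apply: idem_equiv_sym; rewrite -{2}[j]sigmaK; apply: E.
Qed.

Definition conjugates {I : choiceType} (e : dfamily A I) (u v : I -> A)
    (phi : A -> A) : Prop :=
  linear phi /\ forall i j x, corner e i j setT x -> phi x = v i ** x ** u j.

(** The image z of x is prescribed through all the f_(tau i) z f_(tau j), which
    determine it; this makes the choice of z for each x linear in x. *)
Lemma conjugation_exists (I J : choiceType) (e : dfamily A I) (f : dfamily A J)
    tau u v : matching e f tau u v -> exists phi, conjugates e u v phi.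
Proof.
move=> [[sigma tauK sigmaK] E].
have block i j k l x : corner e k l setT x ->
    f (tau i) ** (v k ** x ** u l) ** f (tau j) = v i ** x ** u j.
  move=> xc; have [->|ik] := pselect (i = k); last first.
    rewrite -(idem_equiv_vl (E k)) !numulA idem_orth; last by move/(can_inj tauK).
    have -> : v i ** x = 0; last by rewrite !numul0x.
    rewrite -(idem_equiv_vr (E i)) -(corner_left xc) -numulA [e i ** _]numulA.
    by rewrite idem_orth // numul0x numulx0.
  rewrite !numulA (idem_equiv_vl (E k)).
  have [->|jl] := pselect (j = l); first by rewrite -numulA (idem_equiv_ur (E l)).
  rewrite -(idem_equiv_ur (E l)) -!numulA idem_orth; last first.
    by move/(can_inj tauK)/esym.
  have -> : x ** u j = 0; last by rewrite !numulx0.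
  rewrite -(idem_equiv_ul (E j)) -(corner_right xc) -numulA [e l ** _]numulA.
  by rewrite idem_orth ?numul0x ?numulx0 //; apply/nesym.
have /choice[phi phiP] x : exists z,
    forall i j, f (tau i) ** z ** f (tau j) = v i ** x ** u j.
  elim/(@corner_ind _ _ _ _ e): x => [|x y [z zP] [z' z'P]|k l h x xc].
  - by exists 0 => i j; rewrite !numulx0 !numul0x.
  - by exists (z + z') => i j; rewrite !numulDr !numulDl zP z'P.
  - by exists (v k ** x ** u l) => i j; apply: block (cornerT xc).
have ext z z' : (forall i j, f (tau i) ** z ** f (tau j) =
    f (tau i) ** z' ** f (tau j)) -> z = z'.
  by move=> zz'; apply: (corner_ext (e := f)) => i j; rewrite -[i]sigmaK -[j]sigmaK.
exists phi; split=> [c x y|k l x xc]; apply: ext => i j.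
  by rewrite phiP !numul_linearr !numul_linearl !phiP.
by rewrite phiP block.
Qed.

Section Properties.
Context {I J : choiceType} (e : dfamily A I) (f : dfamily A J).
Variables (tau : I -> J) (sigma : J -> I) (u v : I -> A) (phi psi : A -> A).
Hypothesis m : matching e f tau u v.
Hypothesis phiP : conjugates e u v phi.

Lemma conjugation_idem i : phi (e i) = f (tau i).
Proof.
have [_ E] := m; have [_ /(_ i i)->] := phiP; last exact: corner_idem.
by rewrite (idem_equiv_vr (E i)) (idem_equiv_vu (E i)).
Qed.

Lemma conjugationM : {morph phi : x y / x ** y}.
Proof.
have [_ E] := m; have [phiL phiC] := phiP.
have phi0 := linear_map0 phiL; have phiD := linear_mapD phiL.
move=> x y; elim/(@corner_ind _ _ _ _ e): x => [|x x' px px'|i j h x xc].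
- by rewrite numul0x phi0 numul0x.
- by rewrite numulDl !phiD numulDl px px'.
elim/(@corner_ind _ _ _ _ e): y => [|y y' py py'|k l t y yc].
- by rewrite numulx0 phi0 numulx0.
- by rewrite numulDr !phiD numulDr py py'.
have [xyc xy0] := cornerM xc yc.
rewrite (phiC _ _ _ (cornerT xc)) (phiC _ _ _ (cornerT yc)).
rewrite (phiC _ _ _ (cornerT xyc)).
have [jk|jk] := pselect (j = k); last first.
  rewrite xy0 // numulx0 numul0x -[u j](idem_equiv_ur (E j)).
  rewrite -[v k](idem_equiv_vl (E k)) !numulA.
  rewrite -[_ ** f (tau j) ** f (tau k)]numulA idem_orth.
    by rewrite numulx0 !numul0x.
  by case: m => [[g gK _] _] /(can_inj gK).
subst k; rewrite !numulA -[_ ** u j ** v j]numulA (idem_equiv_uv (E j)).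
by rewrite -[_ ** x ** e j]numulA (corner_right xc).
Qed.

Lemma conjugation_corner i j (X : set A) x :
  corner e i j X x -> corner f (tau i) (tau j) setT (phi x).
Proof.
move=> xc; exists (phi x) => //; rewrite -!conjugation_idem -!conjugationM.
by rewrite (corner_left xc) (corner_right xc).
Qed.

Lemma conjugation_hcomp i j h x :
  corner e i j setT x -> hcomp (h : H) x -> hcomp h (phi x).
Proof.
have [_ E] := m; have [phiL phiC] := phiP.
move=> xc xh; rewrite (phiC _ _ _ xc) -[h]addr0 -[h]add0r.
apply: hcompM (idem_equiv_degl (E j)).
exact: hcompM (idem_equiv_degr (E i)) xh.
Qed.

Hypothesis psiP : conjugates f (v \o sigma) (u \o sigma) psi.
Hypothesis tauK : cancel tau sigma.

Lemma conjugationK : cancel phi psi.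
Proof.
have [_ E] := m; have [phiL phiC] := phiP; have [psiL psiC] := psiP.
move=> x; elim/(@corner_ind _ _ _ _ e): x => [|x y px py|i j h x xc].
- by rewrite (linear_map0 phiL) (linear_map0 psiL).
- by rewrite (linear_mapD phiL) (linear_mapD psiL) px py.
rewrite (psiC _ _ _ (conjugation_corner xc)) (phiC _ _ _ (cornerT xc)) /= !tauK.
rewrite !numulA (idem_equiv_uv (E i)) -numulA (idem_equiv_uv (E j)).
by rewrite (corner_left xc) (corner_right xc).
Qed.

End Properties.
End Conjugation.

(** * Transporting Nakayama forms *)

Section FormTransport.
Context {K : fieldType} {H : zmodType} {A : grAlgType K H}.

Lemma biscalar_comp (B : {biscalar A}) (phi : A -> A) : linear phi ->
  exists B' : {biscalar A}, forall x y, B' x y = B (phi x) (phi y).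
Proof.
move=> phiL.
have BL : bilinear_for (GRing.Scale.Law.clone K K *%R _)
    (GRing.Scale.Law.clone K K *%R _) (fun x y => B (phi x) (phi y)).
  by split=> z c x y /=; rewrite phiL ?form_linearl ?form_linearr.
pose B' : {biscalar A} := HB.pack (fun x y => B (phi x) (phi y))
  (bilinear_isBilinear.Build K A A K _ _ _ BL).
by exists B'.
Qed.

Definition graded_corner_map (V V' : set A) (phi : A -> A) : Prop :=
  [/\ linear phi, (forall v, V v -> V' (phi v)) &
      forall h v, V v -> hcomp (h : H) v -> hcomp h (phi v)].

Lemma graded_dual_comp (V V' : set A) (phi : A -> A) (g : A -> K) :
  graded_corner_map V V' phi -> graded_dual V' g -> graded_dual V (g \o phi).
Proof.
move=> [phiL phiV phih] [gL gS]; split=> [c x y Vx Vy /=|].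
  by rewrite phiL gL //; apply: phiV.
apply: sub_finite_set gS => h [v [Vv vh] gv]; exists (phi v) => //.
by split; [apply: phiV | apply: phih].
Qed.

Lemma represented_comp (B : A -> A -> K) (V V' W W' : set A) (phi psi : A -> A) :
    cancel phi psi -> cancel psi phi ->
    (forall v, V v -> V' (phi v)) -> graded_corner_map V' V psi ->
    (forall w, W w -> W' (phi w)) -> (forall w, W' w -> W (psi w)) ->
    (forall g, graded_dual V' g ->
       exists! w, W' w /\ forall v, V' v -> B v w = g v) ->
  forall g, graded_dual V g ->
    exists! w, W w /\ forall v, V v -> B (phi v) (phi w) = g v.
Proof.
move=> phiK psiK phiV psiV phiW psiW rep g gV.
have [w [[Ww wP] wU]] := rep _ (graded_dual_comp psiV gV).
exists (psi w); split=> [|w' [Ww' w'P]].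
  by split=> [|v Vv]; [apply: psiW | rewrite psiK wP /= ?phiK //; apply: phiV].
rewrite (wU (phi w')) ?phiK //; split=> [|v Vv]; first exact: phiW.
by rewrite /= -w'P ?psiK //; case: psiV => _ + _; apply.
Qed.

(** The transported form is B'(x, y) = B(phi x, phi y), with permutation
    sigma nu tau for sigma the inverse of tau, and degree map d tau. *)
Lemma Nakayama_form_transport (I J : choiceType) (e : dfamily A I)
    (f : dfamily A J) tau u v (B : {biscalar A}) nu d :
    matching e f tau u v -> graded_Nakayama_form f B nu d ->
  exists B' nu' d', graded_Nakayama_form e B' nu' d'.
Proof.
move=> m BN; have [[sigma tauK sigmaK] _] := m.
have m' := matching_sym tauK sigmaK m.
have [phi phiP] := conjugation_exists m.
have [psi psiP] := conjugation_exists m'.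
have phiK := conjugationK m phiP psiP tauK.
have psiK : cancel psi phi.
  apply: (conjugationK m' psiP _ sigmaK); case: phiP => phiL phiC; split=> //.
  by move=> i j x xc; rewrite /= !tauK; apply: phiC.
have phiM := conjugationM m phiP.
have phi_idem := conjugation_idem m phiP.
have [B' B'E] := biscalar_comp B phiP.1.
pose nu' := sigma \o nu \o tau.
have phiV i j : graded_corner_map (corner e i j setT)
    (corner f (tau i) (tau j) setT) phi.
  split=> [|x|h x]; first exact: phiP.1.
    exact: (conjugation_corner m phiP).
  exact: (conjugation_hcomp m phiP).
have psiV i j : graded_corner_map (corner f (tau i) (tau j) setT)
    (corner e i j setT) psi.
  split=> [|x|h x]; first exact: psiP.1.
    by move/(conjugation_corner m' psiP); rewrite !tauK.
  exact: (conjugation_hcomp m' psiP).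
have tau_nu i : tau (nu' i) = nu (tau i) by rewrite /nu' /= sigmaK.
exists B', nu', (d \o tau); split.
- by move=> a b c; rewrite !B'E !phiM (Nakayama_assoc BN).
- move=> i j; split=> [[a [b]]|ji].
    rewrite B'E !phiM !phi_idem => Bab.
    have /(Nakayama_perm BN) : exists a b, B (f (tau i) ** a) (b ** f (tau j)) <> 0.
      by exists (phi a), (phi b).
    by rewrite /nu' /= => <-; rewrite tauK.
  have [a [b Bab]] : exists a b, B (f (tau i) ** a) (b ** f (tau j)) <> 0.
    by apply/(Nakayama_perm BN); rewrite ji tau_nu.
  by exists (psi a), (psi b); rewrite B'E !phiM !phi_idem !psiK.
- have nu_bij := Nakayama_bij BN.
  rewrite /nu'; apply: bij_comp; last by exists sigma.
  by apply: bij_comp => //; exists tau.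
- move=> i j h k x y [xc xh] [yc yk]; rewrite B'E.
  have [_ phix phihx] := phiV i j; have [_ phiy phihy] := phiV j (nu' i).
  rewrite tau_nu in phiy.
  apply: (Nakayama_degree BN (j := tau j) (conj (phix _ xc) (phihx _ _ xc xh))).
  exact: (conj (phiy _ yc) (phihy _ _ yc yk)).
- move=> i j; have := Nakayama_nondeg BN (tau i) (tau j).
  rewrite -tau_nu => -[dl rl dr rr].
  have [_ phix _] := phiV i j; have [_ phiy _] := phiV j (nu' i).
  have [_ psix _] := psiV i j; have [_ psiy _] := psiV j (nu' i).
  split.
  + move=> w Ww; have -> : B'^~ w = (B^~ (phi w)) \o phi.
      by apply/funext => x /=; rewrite B'E.
    by apply: (graded_dual_comp (phiV i j)); apply/dl/phiy.
  + move=> g gV; have [w [[Ww wP] wU]] :=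
      represented_comp phiK psiK phix (psiV i j) phiy psiy rl gV.
    exists w; split=> [|w' [Ww' w'P]]; first by split=> // x xc; rewrite B'E wP.
    by apply: wU; split=> // x xc; rewrite -B'E w'P.
  + move=> x Vx; have -> : B' x = B (phi x) \o phi.
      by apply/funext => y /=; rewrite B'E.
    by apply: (graded_dual_comp (phiV j (nu' i))); apply/dr/phix.
  + move=> g gV; have [w [[Ww wP] wU]] :=
      represented_comp (B := fun y x => B x y)
        phiK psiK phiy (psiV j (nu' i)) phix psix rr gV.
    exists w; split=> [|w' [Ww' w'P]]; first by split=> // x xc; rewrite B'E wP.
    by apply: wU; split=> // x xc; rewrite -B'E w'P.
Qed.

End FormTransport.

Theorem corollary3p5 (K : fieldType) (H : zmodType) (A : eiGrAlgType K H)
    (I : choiceType) (e : dfamily A I)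
    (A_pF : graded_pseudo_Frobenius A) (e_wb : weakly_basic e) :
  (exists eta : algAut A,
     [/\ permutes_family e eta,
         (forall i j x, corner e i j setT x ->
            homogeneous x -> homogeneous (eta x)) &
         bimodule_isomorphic (twist eta) (dual_bimodule e)])
  /\
  (forall (B : {biscalar A}) (nu : I -> I) (d : I -> H) (h : H),
     graded_Nakayama_form e B nu d -> (forall i, d i = h) ->
     exists eta : grAlgAut A,
       permutes_family e eta /\
       gr_bimodule_isomorphic (gr_dual e) (gr_shift (gr_twist eta) h)).
Proof.
split=> [|B nu d h BN d_const].
  have [J [f [_ f_wb [B' [nu' [d' BN']]]]]] := A_pF.
  have [tau [u [v m]]] := matching_exists e_wb f_wb.
  have [B [nu [d BN]]] := Nakayama_form_transport m BN'.
  have [eta etaP] := Nakayama_aut BN; exists eta; split.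
  - by exists nu; [apply: (Nakayama_bij BN) | apply: (Nakayama_aut_idem BN etaP)].
  - exact: (Nakayama_aut_homogeneous BN etaP).
  - by exists (form_dual BN); apply: (form_dual_iso BN etaP).
have [eta etaP] := Nakayama_aut BN.
exists (GrAlgAut (Nakayama_aut_graded BN d_const etaP)); split.
  by exists nu; [apply: (Nakayama_bij BN) | apply: (Nakayama_aut_idem BN etaP)].
exact: (gr_dual_twist_iso BN d_const
  (eta := GrAlgAut (Nakayama_aut_graded BN d_const etaP)) etaP).
Qed.
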